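(* Let $\mathcal{A}$ be an abelian category with subcategories $\mathcal{W}\subseteq\mathcal{X}$ and $\mathcal{V}\subseteq\mathcal{Y}$ such that $\mathcal{X}\perp\mathcal{W}$ and $\mathcal{V}\perp\mathcal{Y}$. Fix objects $M\in\operatorname{res}\widehat{\mathcal{W}}$ and $N\in\operatorname{cores}\widehat{\mathcal{V}}$. (a) The natural transformations $\vartheta^n_{\mathcal{X}\mathcal{W}\mathcal{A}}(M,-)\colon\operatorname{Ext}^n_{\mathcal{X}\mathcal{A}}(M,-)\to\operatorname{Ext}^n_{\mathcal{W}\mathcal{A}}(M,-)$ are isomorphisms for each $n$. (b) The natural transformations $\vartheta^n_{\mathcal{A}\mathcal{Y}\mathcal{V}}(-,N)\colon\operatorname{Ext}^n_{\mathcal{A}\mathcal{Y}}(-,N)\to\operatorname{Ext}^n_{\mathcal{A}\mathcal{V}}(-,N)$ are isomorphisms for each $n$.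
   Context: ''Subcategory'' means full, additive subcategory closed under isomorphisms. For classes $\mathcal{C},\mathcal{D}$ of objects, $\mathcal{C}\perp\mathcal{D}$ means $\operatorname{Ext}^i_{\mathcal{A}}(C,D)=0$ for all $i\geq1$, $C\in\mathcal{C}$, $D\in\mathcal{D}$. Complexes are indexed homologically. For a subcategory $\mathcal{C}$, a $\mathcal{C}$-resolution of $M$ is a complex $C$ of objects of $\mathcal{C}$ with $C_n=0$ for $n<0$, $\operatorname{H}_n(C)=0$ for $n>0$ and $\operatorname{H}_0(C)\cong M$; its augmented resolution is $C^+=\cdots\to C_1\to C_0\to M\to0$. It is proper if $\operatorname{Hom}_{\mathcal{A}}(C',C^+)$ is exact for every $C'\in\mathcal{C}$. $\operatorname{res}\widehat{\mathcal{C}}$ is the subcategory of objects having a bounded $\mathcal{C}$-resolution. Dually, a $\mathcal{C}$-coresolution of $N$ is a complex $C$ of objects of $\mathcal{C}$ with $C_n=0$ for $n>0$, $\operatorname{H}_n(C)=0$ for $n<0$ and $\operatorname{H}_0(C)\cong N$, with augmented coresolution ${}^+C=0\to N\to C_0\to C_{-1}\to\cdots$; it is proper if $\operatorname{Hom}_{\mathcal{A}}({}^+C,C')$ is exact for every $C'\in\mathcal{C}$. $\operatorname{cores}\widehat{\mathcal{C}}$ is the subcategory of objects having a bounded $\mathcal{C}$-coresolution. If $M$ has a proper $\mathcal{C}$-resolution $C\to M$, then $\operatorname{Ext}^n_{\mathcal{C}\mathcal{A}}(M,N)=\operatorname{H}_{-n}(\operatorname{Hom}_{\mathcal{A}}(C,N))$.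 If $N$ has a proper $\mathcal{C}$-coresolution $N\to C$, then $\operatorname{Ext}^n_{\mathcal{A}\mathcal{C}}(M,N)=\operatorname{H}_{-n}(\operatorname{Hom}_{\mathcal{A}}(M,C))$. These are independent of choices, and all (co)resolutions needed here exist under the stated hypotheses. Comparison maps: if $M$ has a proper $\mathcal{W}$-resolution $\gamma\colon W\to M$ and a proper $\mathcal{X}$-resolution $\gamma'\colon X\to M$, there is a morphism $\overline{\operatorname{id}_M}\colon W\to X$, unique up to homotopy (and a quasiisomorphism), with $\gamma=\gamma'\,\overline{\operatorname{id}_M}$; then $\vartheta^n_{\mathcal{X}\mathcal{W}\mathcal{A}}(M,N)=\operatorname{H}_{-n}(\operatorname{Hom}_{\mathcal{A}}(\overline{\operatorname{id}_M},N))$. If $N$ has a proper $\mathcal{Y}$-coresolution $\delta\colon N\to Y$ and a proper $\mathcal{V}$-coresolution $\delta'\colon N\to V$, there is a morphism $\overline{\operatorname{id}_N}\colon Y\to V$, unique up to homotopy (and a quasiisomorphism), with $\delta'=\overline{\operatorname{id}_N}\,\delta$; then $\vartheta^n_{\mathcal{A}\mathcal{Y}\mathcal{V}}(M,N)=\operatorname{H}_{-n}(\operatorname{Hom}_{\mathcal{A}}(M,\overline{\operatorname{id}_N}))$. *)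

(* Defs.v *)
From HB Require Import structures.
From Stdlib Require Import Relation_Operators.
From mathcomp Require Import all_boot all_order all_algebra.
From mathcomp Require Import boolp.

Set Implicit Arguments.
Unset Strict Implicit.
Unset Printing Implicit Defensive.

Import Order.TTheory GRing.Theory Num.Theory.

Declare Scope cat_scope.
Delimit Scope cat_scope with cat.
Local Open Scope ring_scope.
Local Open Scope quotient_scope.
Local Open Scope cat_scope.

(* Categories enriched in abelian groups.  MathComp's [zmodType] also carries a
   choice operator, which every type has by classical choice. *)
Record precat := PreCat {
  obj :> Type;
  hom : obj -> obj -> zmodType;
  idm : forall a, hom a a;
  comp : forall a b c, hom b c -> hom a b -> hom a c;
  comp1m : forall a b (f : hom a b), comp (idm b) f = f;
  compm1 : forall a b (f : hom a b), comp f (idm a) = f;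
  compA : forall a b c d (h : hom c d) (g : hom b c) (f : hom a b),
    comp h (comp g f) = comp (comp h g) f;
  compDl : forall a b c (g g' : hom b c) (f : hom a b),
    comp (g + g') f = comp g f + comp g' f;
  compDr : forall a b c (g : hom b c) (f f' : hom a b),
    comp g (f + f') = comp g f + comp g f' }.

Arguments idm {p} a.
Arguments comp {p a b c} g f.
Notation "g ∘ f" := (comp g f) (at level 40, left associativity) : cat_scope.

Definition op (C : precat) : precat :=
  @PreCat C (fun a b => hom b a) (fun a => idm a) (fun _ _ _ g f => f ∘ g)
    (fun _ _ f => compm1 f) (fun _ _ f => comp1m f)
    (fun _ _ _ _ h g f => esym (compA f g h))
    (fun _ _ _ g g' f => compDr f g g') (fun _ _ _ g f f' => compDl f f' g).

Section Notions.
Variable C : precat.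
Implicit Types a b c : C.

Definition is_zero a : Prop :=
  forall b, (forall f g : hom a b, f = g) /\ (forall f g : hom b a, f = g).

Definition is_iso a b (f : hom a b) : Prop :=
  exists g : hom b a, g ∘ f = idm a /\ f ∘ g = idm b.

Definition isomorphic a b : Prop := exists f : hom a b, is_iso f.

Definition mono a b (f : hom a b) : Prop :=
  forall c (g h : hom c a), f ∘ g = f ∘ h -> g = h.

Definition epi a b (f : hom a b) : Prop :=
  forall c (g h : hom b c), g ∘ f = h ∘ f -> g = h.

Definition is_kernel k a b (f : hom a b) (i : hom k a) : Prop :=
  f ∘ i = 0 /\
  forall t (u : hom t a), f ∘ u = 0 -> exists! v : hom t k, i ∘ v = u.

Definition is_cokernel a b q (f : hom a b) (p : hom b q) : Prop :=
  p ∘ f = 0 /\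
  forall t (u : hom b t), u ∘ f = 0 -> exists! v : hom q t, v ∘ p = u.

Definition is_biproduct a b s : Prop :=
  exists (i1 : hom a s) (i2 : hom b s) (p1 : hom s a) (p2 : hom s b),
    [/\ p1 ∘ i1 = idm a, p2 ∘ i2 = idm b, p1 ∘ i2 = 0, p2 ∘ i1 = 0
      & i1 ∘ p1 + i2 ∘ p2 = idm s].

Record abelian : Prop := Abelian {
  ab_zero : exists z : C, is_zero z;
  ab_biproduct : forall a b, exists s, is_biproduct a b s;
  ab_kernel : forall a b (f : hom a b), exists k (i : hom k a), is_kernel f i;
  ab_cokernel : forall a b (f : hom a b),
    exists q (p : hom b q), is_cokernel f p;
  ab_mono : forall a b (f : hom a b), mono f ->
    exists c (g : hom b c), is_kernel g f;
  ab_epi : forall a b (f : hom a b), epi f ->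
    exists c (g : hom c a), is_cokernel g f }.

Record subcat := Subcat {
  in_sub :> C -> Prop;
  sub_iso : forall a b, isomorphic a b -> in_sub a -> in_sub b;
  sub_zero : exists z, is_zero z /\ in_sub z;
  sub_biproduct : forall a b s, is_biproduct a b s ->
    in_sub a -> in_sub b -> in_sub s }.

Definition sub_le (S T : subcat) : Prop := forall a, S a -> T a.

End Notions.

Section Yoneda.
Variable C : precat.
Implicit Types a b c d : C.

Record ses c d := Ses {
  ses_mid : C;
  ses_inj : hom d ses_mid;
  ses_surj : hom ses_mid c;
  ses_kernel : is_kernel ses_surj ses_inj;
  ses_cokernel : is_cokernel ses_inj ses_surj }.

Definition ses_mor c d c' d' (g : hom c c') (f : hom d d')
    (E : ses c d) (E' : ses c' d') : Prop :=
  exists h : hom (ses_mid E) (ses_mid E'),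
    h ∘ ses_inj E = ses_inj E' ∘ f /\ ses_surj E' ∘ h = g ∘ ses_surj E.

(* [yext n c d], for [n >= 1], is the type of exact sequences
   [0 -> d -> E_n -> ... -> E_1 -> c -> 0], each given as the splice of its
   short exact sequences: in [0 -> d -> E_n -> k -> 0], the object [k] is the
   image of [E_n -> E_{n-1}]. *)
Fixpoint yext (n : nat) c d : Type :=
  match n with
  | 0 => hom c d
  | m.+1 => match m with
            | 0 => ses c d
            | _.+1 => {k : C & (ses k d * yext m c k)%type}
            end
  end.

Fixpoint yext_mor (n : nat) c d c' d' (g : hom c c') (f : hom d d') {struct n} :
    yext n c d -> yext n c' d' -> Prop :=
  match n return yext n c d -> yext n c' d' -> Prop with
  | 0 => fun e e' => f ∘ e = e' ∘ g
  | m.+1 =>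
    match m return
      (forall k k', hom k k' -> yext m c k -> yext m c' k' -> Prop) ->
      yext m.+1 c d -> yext m.+1 c' d' -> Prop
    with
    | 0 => fun _ E E' => ses_mor g f E E'
    | _.+1 => fun mor E E' =>
        exists h : hom (projT1 E) (projT1 E'),
          ses_mor h f (projT2 E).1 (projT2 E').1 /\
          mor _ _ h (projT2 E).2 (projT2 E').2
    end (fun k k' h => yext_mor g h)
  end.

(* Yoneda equivalence; [Ext^n(c, d)] is the set of its classes. *)
Definition yext_equiv (n : nat) c d : yext n c d -> yext n c d -> Prop :=
  clos_refl_sym_trans _ (yext_mor (idm c) (idm d)).

(* [Ext^n(c, d) = 0]: the group has a single element. *)
Definition ext_vanishes (n : nat) c d : Prop :=
  forall E E' : yext n c d, yext_equiv E E'.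

Definition perp (S T : C -> Prop) : Prop :=
  forall c d, S c -> T d -> forall i : nat, (1 <= i)%N -> ext_vanishes i c d.

End Yoneda.

(* All maps [cd i j] are present, those with [i <> j + 1] being zero; this
   avoids transporting along equations between indices. *)
Record complex (C : precat) := Complex {
  cx :> int -> C;
  cd : forall i j, hom (cx i) (cx j);
  cd_shape : forall i j, i != j + 1 -> cd i j = 0;
  cd_cd : forall i j k, cd j k ∘ cd i j = 0 }.

Record chain_map (C : precat) (X Y : complex C) := ChainMap {
  cm :> forall i, hom (X i) (Y i);
  cm_comm : forall i j, cm j ∘ cd X i j = cd Y i j ∘ cm i }.

(* [z] is the inclusion of the cycles [Z] in degree [n], and [p] is a quotient
   map from [Z] onto the homology object [H]. *)
Definition is_homology (C : precat) (X : complex C) (n : int)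
    (Z H : C) (z : hom Z (X n)) (p : hom Z H) : Prop :=
  is_kernel (cd X n (n - 1)) z /\
  exists b : hom (X (n + 1)) Z, z ∘ b = cd X (n + 1) n /\ is_cokernel b p.

Definition homology_vanishes (C : precat) (X : complex C) (n : int) : Prop :=
  exists (Z H : C) (z : hom Z (X n)) (p : hom Z H),
    is_homology z p /\ is_zero H.

Record zcomplex := ZComplex {
  zx :> int -> zmodType;
  zd : forall i j, {additive zx i -> zx j};
  zd_shape : forall i j x, i != j + 1 -> zd i j x = 0;
  zd_zd : forall i j k x, zd j k (zd i j x) = 0 }.

Record zchain_map (G K : zcomplex) := ZChainMap {
  zm :> forall i, {additive G i -> K i};
  zm_comm : forall i j x, zm j (zd G i j x) = zd K i j (zm i x) }.

Section ZHomology.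
Variables (G : zcomplex) (n : int).

Definition zcycle : {pred G n} := fun x => zd G n (n - 1) x == 0.

Fact zcycle_closed : zmod_closed zcycle.
Proof.
split=> [|x y]; rewrite !unfold_in ?raddf0 // => /eqP hx /eqP hy.
by rewrite raddfB hx hy subr0.
Qed.
HB.instance Definition _ := GRing.isZmodClosed.Build _ zcycle zcycle_closed.

Record zcycles := ZCycle { zcycle_val : G n; _ : zcycle_val \in zcycle }.
HB.instance Definition _ := [isSub for zcycle_val].
HB.instance Definition _ := [Choice of zcycles by <:].
HB.instance Definition _ := [SubChoice_isSubZmodule of zcycles by <:].

Definition zboundary : {pred zcycles} :=
  fun x => `[< exists y, zd G (n + 1) n y = val x >].

Fact zboundary_closed : zmod_closed zboundary.
Proof.
split=> [|x y].
  by rewrite unfold_in; apply/asboolP; exists 0; rewrite !raddf0.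
rewrite !unfold_in => /asboolP[u hu] /asboolP[v hv].
by apply/asboolP; exists (u - v); rewrite !raddfB /= hu hv.
Qed.
HB.instance Definition _ :=
  GRing.isZmodClosed.Build _ zboundary zboundary_closed.

Definition zhomology : zmodType := Quotient.quot zboundary.

End ZHomology.

Definition zexact (G : zcomplex) : Prop :=
  forall n (x : zhomology G n), x = 0.

Section ZHomologyMap.
Variables (G K : zcomplex) (f : zchain_map G K) (n : int).

Fact zcycle_map_subproof (x : zcycles G n) : f n (val x) \in @zcycle K n.
Proof.
case: x => x /=; rewrite !unfold_in => /eqP hx.
by rewrite -zm_comm hx raddf0.
Qed.

Definition zcycle_map (x : zcycles G n) : zcycles K n :=
  ZCycle (zcycle_map_subproof x).

(* The homology class of [f x], for [x] a representing cycle. *)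
Definition zhomology_map (u : zhomology G n) : zhomology K n :=
  \pi_(zhomology K n) (zcycle_map (repr u)).

Lemma zhomology_map_pi (x : zcycles G n) :
  zhomology_map (\pi_(zhomology G n) x) = \pi_(zhomology K n) (zcycle_map x).
Proof.
rewrite /zhomology_map; apply/eqP; rewrite -Quotient.idealrBE.
have : repr (\pi_(zhomology G n) x) - x \in @zboundary G n.
  by rewrite Quotient.idealrBE reprK.
rewrite !unfold_in => /asboolP[y hy]; apply/asboolP; exists (f (n + 1) y).
by rewrite -zm_comm hy !raddfB.
Qed.

Fact zhomology_map_is_zmod_morphism : zmod_morphism zhomology_map.
Proof.
move=> u v; rewrite -[u]reprK -[v]reprK -raddfB !zhomology_map_pi -raddfB.
by congr (\pi _); apply: val_inj; rewrite /= !raddfB.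
Qed.
HB.instance Definition _ := GRing.isZmodMorphism.Build _ _ zhomology_map
  zhomology_map_is_zmod_morphism.

End ZHomologyMap.

Arguments zhomology_map {G K} f n u.

Lemma zhomology_map_id (G : zcomplex) (f : zchain_map G G) n u :
  (forall i x, f i x = x) -> zhomology_map f n u = u.
Proof.
move=> hf; rewrite -[u]reprK zhomology_map_pi.
by congr (\pi _); apply: val_inj; rewrite /= hf.
Qed.

Lemma zhomology_map_comp (G K L : zcomplex) (h : zchain_map G L)
    (g : zchain_map K L) (f : zchain_map G K) n u :
  (forall i x, h i x = g i (f i x)) ->
  zhomology_map h n u = zhomology_map g n (zhomology_map f n u).
Proof.
move=> hgf; rewrite -[u]reprK (zhomology_map_pi h) (zhomology_map_pi f).
by rewrite (zhomology_map_pi g); congr (\pi _); apply: val_inj; rewrite /= hgf.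
Qed.

Lemma zhomology_map_square (G K K' L : zcomplex) (g : zchain_map K L)
    (f : zchain_map G K) (g' : zchain_map K' L) (f' : zchain_map G K') n u :
  (forall i x, g i (f i x) = g' i (f' i x)) ->
  zhomology_map g n (zhomology_map f n u) =
  zhomology_map g' n (zhomology_map f' n u).
Proof.
move=> h; rewrite -[u]reprK (zhomology_map_pi f) (zhomology_map_pi f').
rewrite (zhomology_map_pi g) (zhomology_map_pi g').
by congr (\pi _); apply: val_inj; rewrite /= h.
Qed.

Record abfunctor (C : precat) := AbFunctor {
  fobj :> C -> zmodType;
  fmap : forall a b, hom a b -> {additive fobj a -> fobj b};
  fmap1 : forall a x, fmap (idm a) x = x;
  fmapM : forall a b c (g : hom b c) (f : hom a b) x,
    fmap (g ∘ f) x = fmap g (fmap f x) }.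

Record nat_trans (C : precat) (F G : abfunctor C) := NatTrans {
  nt :> forall a, {additive F a -> G a};
  nt_natural : forall a b (f : hom a b) x,
    nt b (fmap F f x) = fmap G f (nt a x) }.

Definition is_nat_iso (C : precat) (F G : abfunctor C) (t : nat_trans F G) :=
  exists s : nat_trans G F,
    forall a, (forall x, s a (t a x) = x) /\ (forall y, t a (s a y) = y).

Section Composition.
Variables (C : precat) (a b c : C).

Fact comp0m (f : hom a b) : (0 : hom b c) ∘ f = 0.
Proof. by apply: (addrI (0 ∘ f)); rewrite -compDl !addr0. Qed.

Fact compm0 (g : hom b c) : g ∘ (0 : hom a b) = 0.
Proof. by apply: (addrI (g ∘ 0)); rewrite -compDr !addr0. Qed.

Definition precomp (f : hom a b) (g : hom b c) : hom a c := g ∘ f.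
Definition postcomp (g : hom b c) (f : hom a b) : hom a c := g ∘ f.

Fact precomp_is_nmod_morphism f : nmod_morphism (precomp f).
Proof. by split=> [|g h]; rewrite /precomp ?comp0m ?compDl. Qed.
HB.instance Definition _ f := GRing.isNmodMorphism.Build _ _ (precomp f)
  (precomp_is_nmod_morphism f).

Fact postcomp_is_nmod_morphism g : nmod_morphism (postcomp g).
Proof. by split=> [|f h]; rewrite /postcomp ?compm0 ?compDr. Qed.
HB.instance Definition _ g := GRing.isNmodMorphism.Build _ _ (postcomp g)
  (postcomp_is_nmod_morphism g).

End Composition.

Section HomComplexes.
Variable C : precat.

(* [Hom(X, N)] has [Hom(X_{-i}, N)] in degree [i].  The usual signs of its
   differential are omitted: they change neither its cycles nor its
   boundaries. *)
Section Left.
Variables (X : complex C) (N : C).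

Fact homXN_shape (i j : int) (x : hom (X (- i)) N) :
  i != j + 1 -> precomp (cd X (- j) (- i)) x = 0.
Proof.
move=> hij; rewrite /precomp cd_shape ?compm0 //.
apply: contra hij => /eqP h.
by apply/eqP; rewrite -[j]opprK h opprD opprK addrNK.
Qed.

Fact homXN_dd (i j k : int) (x : hom (X (- i)) N) :
  precomp (cd X (- k) (- j)) (precomp (cd X (- j) (- i)) x) = 0.
Proof. by rewrite /precomp -compA cd_cd compm0. Qed.

Definition homXN : zcomplex :=
  @ZComplex (fun i => hom (X (- i)) N)
    (fun i j => precomp (cd X (- j) (- i))) homXN_shape homXN_dd.

End Left.

Section Right.
Variables (M : C) (X : complex C).

Fact homMX_shape (i j : int) (x : hom M (X i)) :
  i != j + 1 -> postcomp (cd X i j) x = 0.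
Proof. by move=> hij; rewrite /postcomp cd_shape ?comp0m. Qed.

Fact homMX_dd (i j k : int) (x : hom M (X i)) :
  postcomp (cd X j k) (postcomp (cd X i j) x) = 0.
Proof. by rewrite /postcomp compA cd_cd comp0m. Qed.

Definition homMX : zcomplex :=
  @ZComplex (fun i => hom M (X i))
    (fun i j => postcomp (cd X i j)) homMX_shape homMX_dd.

End Right.

Section Maps.
Variables (X Y : complex C) (f : chain_map X Y) (M N : C) (g : hom M N).

Fact homXN_pre_comm (i j : int) (x : hom (Y (- i)) N) :
  precomp (f (- j)) (precomp (cd Y (- j) (- i)) x) =
  precomp (cd X (- j) (- i)) (precomp (f (- i)) x).
Proof. by rewrite /precomp -!compA cm_comm. Qed.

Definition homXN_pre : zchain_map (homXN Y N) (homXN X N) :=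
  @ZChainMap (homXN Y N) (homXN X N)
    (fun i => precomp (f (- i))) homXN_pre_comm.

Fact homXN_post_comm (i j : int) (x : hom (X (- i)) M) :
  postcomp g (precomp (cd X (- j) (- i)) x) =
  precomp (cd X (- j) (- i)) (postcomp g x).
Proof. by rewrite /precomp /postcomp compA. Qed.

Definition homXN_post : zchain_map (homXN X M) (homXN X N) :=
  @ZChainMap (homXN X M) (homXN X N)
    (fun i => postcomp g) homXN_post_comm.

Fact homMX_post_comm (i j : int) (x : hom M (X i)) :
  postcomp (f j) (postcomp (cd X i j) x) =
  postcomp (cd Y i j) (postcomp (f i) x).
Proof. by rewrite /postcomp !compA cm_comm. Qed.

Definition homMX_post : zchain_map (homMX M X) (homMX M Y) :=
  @ZChainMap (homMX M X) (homMX M Y)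
    (fun i => postcomp (f i)) homMX_post_comm.

Fact homMX_pre_comm (i j : int) (x : hom N (X i)) :
  precomp g (postcomp (cd X i j) x) = postcomp (cd X i j) (precomp g x).
Proof. by rewrite /precomp /postcomp compA. Qed.

Definition homMX_pre : zchain_map (homMX N X) (homMX M X) :=
  @ZChainMap (homMX N X) (homMX M X)
    (fun i => precomp g) homMX_pre_comm.

End Maps.

End HomComplexes.

Section Resolutions.
Variable C : precat.
Implicit Types (S : subcat C) (M N : C).

(* [res_aug] is the composite [X_0 -> H_0(X) ~ M]. *)
Record resolution S M := Resolution {
  res_cx :> complex C;
  res_in : forall n, S (res_cx n);
  res_neg : forall n : int, n < 0 -> is_zero (res_cx n);
  res_acyclic : forall n : int, 0 < n -> homology_vanishes res_cx n;
  res_aug : hom (res_cx 0) M;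
  res_aug_d : forall i, res_aug ∘ cd res_cx i 0 = 0;
  res_H0 : exists (Z : C) (z : hom Z (res_cx 0)),
    is_homology z (res_aug ∘ z) }.

(* [cores_aug] is the composite [N ~ H_0(X) -> X_0]. *)
Record coresolution S N := Coresolution {
  cores_cx :> complex C;
  cores_in : forall n, S (cores_cx n);
  cores_pos : forall n : int, 0 < n -> is_zero (cores_cx n);
  cores_acyclic : forall n : int, n < 0 -> homology_vanishes cores_cx n;
  cores_aug : hom N (cores_cx 0);
  cores_d_aug : forall i, cd cores_cx 0 i ∘ cores_aug = 0;
  cores_H0 : exists (Z : C) (z : hom Z (cores_cx 0)) (p : hom Z N),
    is_homology z p /\ cores_aug ∘ p = z }.

Definition res_hat S M : Prop :=
  exists (X : resolution S M) (b : int), forall n, b < n -> is_zero (X n).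

Definition cores_hat S N : Prop :=
  exists (X : coresolution S N) (b : int), forall n, n < b -> is_zero (X n).

(* The augmented resolution, with [M] in degree [-1]; in the degrees below it
   has the zero objects of the resolution. *)
Section Augmented.
Variables (S : subcat C) (M : C) (X : resolution S M).

Definition aug_obj (n : int) : C :=
  match n with
  | Posz k => X (Posz k)
  | Negz 0 => M
  | Negz k.+1 => X (Negz k.+1)
  end.

Definition aug_d (i j : int) : hom (aug_obj i) (aug_obj j) :=
  match i, j return hom (aug_obj i) (aug_obj j) with
  | Posz i', Posz j' => cd X (Posz i') (Posz j')
  | Posz 0, Negz 0 => res_aug X
  | _, _ => 0
  end.

Fact aug_d_shape i j : i != j + 1 -> aug_d i j = 0.
Proof.
case: i => [[|i]|[|i]]; case: j => [[|j]|[|j]] //= h; exact: cd_shape.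
Qed.

Fact aug_d_d i j k : aug_d j k ∘ aug_d i j = 0.
Proof.
case: i => [[|i]|[|i]]; case: j => [[|j]|[|j]]; case: k => [[|k]|[|k]];
  rewrite /= ?comp0m ?compm0 ?cd_cd ?res_aug_d //.
Qed.

Definition augmented : complex C := Complex aug_d_shape aug_d_d.

Definition proper_res : Prop := forall c : C, S c -> zexact (homMX c augmented).

End Augmented.

(* The augmented coresolution, with [N] in degree [1]. *)
Section Coaugmented.
Variables (S : subcat C) (N : C) (X : coresolution S N).

Definition coaug_obj (n : int) : C :=
  match n with
  | Posz 1 => N
  | Posz k => X (Posz k)
  | Negz k => X (Negz k)
  end.

Definition coaug_d (i j : int) : hom (coaug_obj i) (coaug_obj j) :=
  match i, j return hom (coaug_obj i) (coaug_obj j) with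
  | Posz 1, Posz 0 => cores_aug X
  | Posz 0, Negz j' => cd X 0 (Negz j')
  | Negz i', Negz j' => cd X (Negz i') (Negz j')
  | _, _ => 0
  end.

Fact coaug_d_shape i j : i != j + 1 -> coaug_d i j = 0.
Proof.
case: i => [[|[|i]]|i]; case: j => [[|[|j]]|j] //= h; exact: cd_shape.
Qed.

Fact coaug_d_d i j k : coaug_d j k ∘ coaug_d i j = 0.
Proof.
case: i => [[|[|i]]|i]; case: j => [[|[|j]]|j]; case: k => [[|[|k]]|k];
  rewrite /= ?comp0m ?compm0 ?cd_cd ?cores_d_aug //.
Qed.

Definition coaugmented : complex C := Complex coaug_d_shape coaug_d_d.

Definition proper_cores : Prop :=
  forall c : C, S c -> zexact (homXN coaugmented c).

End Coaugmented.

End Resolutions.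

Section RelativeExt.
Variable C : precat.

Section Res.
Variables (S : subcat C) (M : C) (X : resolution S M) (n : int).

Definition ext_res_map N N' (g : hom N N') :
    {additive zhomology (homXN X N) (- n) -> zhomology (homXN X N') (- n)} :=
  zhomology_map (homXN_post X g) (- n).

Fact ext_res_map1 N x : ext_res_map (idm N) x = x.
Proof. by apply: zhomology_map_id => i y; exact: comp1m. Qed.

Fact ext_res_mapM a b c (g : hom b c) (f : hom a b) x :
  ext_res_map (g ∘ f) x = ext_res_map g (ext_res_map f x).
Proof. by apply: zhomology_map_comp => i y; exact: esym (compA _ _ _). Qed.

(* [Ext^n_{S A}(M, -)], computed from the resolution [X], to be proper. *)
Definition ext_res : abfunctor C := AbFunctor ext_res_map1 ext_res_mapM.

End Res.

Section Cores.
Variables (S : subcat C) (N : C) (X : coresolution S N) (n : int).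

Definition ext_cores_map (M M' : op C) (g : hom M M') :
    {additive zhomology (@homMX C M X) (- n) ->
              zhomology (@homMX C M' X) (- n)} :=
  zhomology_map (@homMX_pre C X M' M g) (- n).

Fact ext_cores_map1 M x : ext_cores_map (idm M) x = x.
Proof. by apply: zhomology_map_id => i y; exact: compm1. Qed.

Fact ext_cores_mapM (a b c : op C) (g : hom b c) (f : hom a b) x :
  ext_cores_map (g ∘ f) x = ext_cores_map g (ext_cores_map f x).
Proof. by apply: zhomology_map_comp => i y; exact: (@compA C). Qed.

(* [Ext^n_{A S}(-, N)], computed from the coresolution [X], to be proper. *)
Definition ext_cores : abfunctor (op C) :=
  AbFunctor ext_cores_map1 ext_cores_mapM.

End Cores.

Section Comparison.
Variables (S T : subcat C).

(* The augmentations are chain maps to [M] placed in degree [0], so they need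
   only be compared in that degree. *)
Definition lifts_id M (P : resolution S M) (Q : resolution T M)
    (f : chain_map P Q) : Prop :=
  res_aug P = res_aug Q ∘ f 0.

Definition colifts_id N (P : coresolution S N) (Q : coresolution T N)
    (f : chain_map P Q) : Prop :=
  cores_aug Q = f 0 ∘ cores_aug P.

Section Theta.
Variables (M : C) (P : resolution S M) (Q : resolution T M).
Variables (f : chain_map P Q) (n : int).

Definition theta_res_at N : {additive ext_res Q n N -> ext_res P n N} :=
  zhomology_map (homXN_pre f N) (- n).

Fact theta_res_natural N N' (g : hom N N') x :
  theta_res_at N' (fmap (ext_res Q n) g x) =
  fmap (ext_res P n) g (theta_res_at N x).
Proof. by apply: zhomology_map_square => i y; exact: esym (compA _ _ _). Qed.

Definition theta_res : nat_trans (ext_res Q n) (ext_res P n) :=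
  NatTrans theta_res_natural.

End Theta.

Section CoTheta.
Variables (N : C) (P : coresolution S N) (Q : coresolution T N).
Variables (f : chain_map P Q) (n : int).

Definition theta_cores_at (M : op C) :
    {additive ext_cores P n M -> ext_cores Q n M} :=
  zhomology_map (@homMX_post C P Q f M) (- n).

Fact theta_cores_natural (M M' : op C) (g : hom M M') x :
  theta_cores_at M' (fmap (ext_cores P n) g x) =
  fmap (ext_cores Q n) g (theta_cores_at M x).
Proof. by apply: zhomology_map_square => i y; exact: compA. Qed.

Definition theta_cores : nat_trans (ext_cores P n) (ext_cores Q n) :=
  NatTrans theta_cores_natural.

End CoTheta.

End Comparison.

End RelativeExt.

(* Main.v *)
(* A bounded W-resolution B of M is X-proper.  Since the terms of B have no
   higher extensions by objects of X, this is dimension shifting along the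
   syzygies of B.  To avoid the long exact sequence of Yoneda Ext, read a class
   of degree n as a cocycle f : z -> d on a partial resolution
   0 -> z -> F_n -> ... -> F_1 -> x -> 0 of x: if the Yoneda group vanishes, then
   every such cocycle becomes a coboundary after refining F, and in this form
   the shift only needs pullbacks of epimorphisms.  Hence for proper
   resolutions P by W and Q by X there are lifts Q -> B -> P of the identity of
   M, and their composite is inverse, up to homotopy, to any lift P -> Q.
   Part (b) is part (a) in the opposite category. *)

From Stdlib Require Import Relation_Operators.
From mathcomp Require Import all_boot all_order all_algebra.
From mathcomp Require Import boolp.
Require Import Defs.

Set Implicit Arguments.
Unset Strict Implicit.
Unset Printing Implicit Defensive.

Import Order.TTheory GRing.Theory Num.Theory.
Local Open Scope ring_scope.
Local Open Scope cat_scope.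

(** * Cancellation, kernels and zero objects in preadditive categories *)

Section Preadditive.
Variable C : precat.
Implicit Types a b c d : C.

Lemma compBl a b c (g g' : hom b c) (f : hom a b) :
  (g - g') ∘ f = g ∘ f - g' ∘ f.
Proof. exact: (raddfB (precomp f)). Qed.

Lemma compBr a b c (g : hom b c) (f f' : hom a b) :
  g ∘ (f - f') = g ∘ f - g ∘ f'.
Proof. exact: (raddfB (postcomp g)). Qed.

Lemma mono_of_cancel0 a b (f : hom a b) :
  (forall c (u : hom c a), f ∘ u = 0 -> u = 0) -> mono f.
Proof.
move=> h c u v e; apply/eqP; rewrite -subr_eq0; apply/eqP/h.
by rewrite compBr e subrr.
Qed.

Lemma mono_cancel0 a b c (f : hom a b) (u : hom c a) :
  mono f -> f ∘ u = 0 -> u = 0.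
Proof. by move=> hf e; apply: hf; rewrite e compm0. Qed.

Lemma epi_of_cancel0 a b (f : hom a b) :
  (forall c (u : hom b c), u ∘ f = 0 -> u = 0) -> epi f.
Proof.
move=> h c u v e; apply/eqP; rewrite -subr_eq0; apply/eqP/h.
by rewrite compBl e subrr.
Qed.

Lemma epi_cancel0 a b c (f : hom a b) (u : hom b c) :
  epi f -> u ∘ f = 0 -> u = 0.
Proof. by move=> hf e; apply: hf; rewrite e comp0m. Qed.

Lemma epi_comp a b c (g : hom b c) (f : hom a b) : epi g -> epi f -> epi (g ∘ f).
Proof. by move=> hg hf d u v; rewrite !compA => /hf /hg. Qed.

Lemma kernel_mono k a b (f : hom a b) (i : hom k a) : is_kernel f i -> mono i.
Proof.
move=> [fi0 hi] c u v e.
have fu0 : f ∘ (i ∘ u) = 0 by rewrite compA fi0 comp0m.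
by have [w [_ hw]] := hi _ _ fu0; rewrite -(hw u) // (hw v).
Qed.

Lemma kernel_lift k a b (f : hom a b) (i : hom k a) t (u : hom t a) :
  is_kernel f i -> f ∘ u = 0 -> exists v : hom t k, i ∘ v = u.
Proof. by move=> [_ hi] /hi [v [hv _]]; exists v. Qed.

Lemma kernel_of_mono k a b (f : hom a b) (i : hom k a) :
  f ∘ i = 0 -> mono i ->
  (forall t (u : hom t a), f ∘ u = 0 -> exists v : hom t k, i ∘ v = u) ->
  is_kernel f i.
Proof.
move=> fi0 hi h; split=> // t u /h [v hv]; exists v; split=> // w hw.
by apply: hi; rewrite hv.
Qed.

Lemma hom_to_zero a b (f g : hom a b) : is_zero b -> f = g.
Proof. by move=> /(_ a) [_ h]. Qed.

Lemma hom_from_zero a b (f g : hom a b) : is_zero a -> f = g.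
Proof. by move=> /(_ b) [h _]. Qed.

End Preadditive.

(** * Cokernels and short exact sequences through the opposite category *)

Section CokernelDual.
Variable C : precat.
Implicit Types a b c d : C.

Lemma cokernel_epi a b q (f : hom a b) (p : hom b q) : is_cokernel f p -> epi p.
Proof. exact: (@kernel_mono (op C)). Qed.

Lemma cokernel_factor a b q (f : hom a b) (p : hom b q) t (u : hom b t) :
  is_cokernel f p -> u ∘ f = 0 -> exists v : hom q t, v ∘ p = u.
Proof. exact: (@kernel_lift (op C)). Qed.

Lemma cokernel_of_epi a b q (f : hom a b) (p : hom b q) :
  p ∘ f = 0 -> epi p ->
  (forall t (u : hom b t), u ∘ f = 0 -> exists v : hom q t, v ∘ p = u) ->
  is_cokernel f p.
Proof. exact: (@kernel_of_mono (op C)). Qed.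

Lemma is_zero_op a : is_zero a -> @is_zero (op C) a.
Proof. by move=> h b; have [] := h b. Qed.

Lemma is_biproduct_op a b s : is_biproduct a b s -> @is_biproduct (op C) a b s.
Proof.
by move=> [i1 [i2 [p1 [p2 [h1 h2 h3 h4 h5]]]]]; exists p1, p2, i1, i2; split.
Qed.

Lemma abelian_op : abelian C -> abelian (op C).
Proof.
case=> hz hb hk hc hm he; split.
- by have [z /is_zero_op] := hz; exists z.
- by move=> a b; have [s /is_biproduct_op] := hb a b; exists s.
- by move=> a b f; exact: hc.
- by move=> a b f; exact: hk.
- by move=> a b f; exact: he.
- by move=> a b f; exact: hm.
Qed.

Definition ses_op c d (E : ses c d) : @ses (op C) d c :=
  @Ses (op C) d c (ses_mid E) (ses_surj E) (ses_inj E)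
    (ses_cokernel E) (ses_kernel E).

Definition ses_unop c d (E : @ses (op C) d c) : ses c d :=
  @Ses C c d (ses_mid E) (ses_surj E) (ses_inj E)
    (ses_cokernel E) (ses_kernel E).

Lemma ses_mor_op c d c' d' (g : hom c c') (f : hom d d') (E : ses c d)
    (E' : ses c' d') :
  ses_mor g f E E' -> @ses_mor (op C) _ _ _ _ f g (ses_op E') (ses_op E).
Proof. by move=> [h [h1 h2]]; exists h. Qed.

End CokernelDual.

(** * Short exact sequences, pullbacks and lifting along epimorphisms *)

Section ShortExact.
Variable C : precat.
Hypothesis hC : abelian C.
Implicit Types a b c d k x y z : C.

Lemma ses_inj_mono c d (E : ses c d) : mono (ses_inj E).
Proof. exact: kernel_mono (ses_kernel E). Qed.

Lemma ses_surj_epi c d (E : ses c d) : epi (ses_surj E).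
Proof. exact: cokernel_epi (ses_cokernel E). Qed.

Lemma ses_surj_inj c d (E : ses c d) : ses_surj E ∘ ses_inj E = 0.
Proof. by have [] := ses_kernel E. Qed.

(** The epimorphism [p] is a cokernel of some [g], and [g] factors through [i]; so a map killing [i]
    kills [g]. *)
Lemma epi_cokernel k a b (p : hom a b) (i : hom k a) :
  epi p -> is_kernel p i -> is_cokernel i p.
Proof.
move=> hp hi; have [c [g hg]] := ab_epi hC hp.
apply: cokernel_of_epi => //; first by case: hi.
move=> t u ui0; have [g' hg'] : exists g' : hom c k, i ∘ g' = g.
  by apply: kernel_lift hi _; case: hg.
by apply: cokernel_factor hg _; rewrite -hg' compA ui0 comp0m.
Qed.

Definition epi_ses k a b (p : hom a b) (i : hom k a) (hp : epi p)
    (hi : is_kernel p i) : ses b k :=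
  Ses hi (epi_cokernel hp hi).

Lemma ses_mor_ker c d c' d' (g : hom c c') (E : ses c d) (E' : ses c' d')
    (h : hom (ses_mid E) (ses_mid E')) :
  ses_surj E' ∘ h = g ∘ ses_surj E ->
  exists f : hom d d', ses_inj E' ∘ f = h ∘ ses_inj E.
Proof.
move=> e; apply: kernel_lift (ses_kernel E') _.
by rewrite compA e -compA ses_surj_inj compm0.
Qed.

(** The middle term is the kernel of [q = p ∘ p1 - f ∘ p2] on the biproduct of [ses_mid E] and
    [y]. *)
Lemma ses_pullback k d y (E : ses k d) (f : hom y k) :
  exists E' : ses y d, ses_mor f (idm d) E' E.
Proof.
set p := ses_surj E; set i := ses_inj E.
have [s [i1 [i2 [p1 [p2 [e11 e22 e12 e21 es]]]]]] := ab_biproduct hC (ses_mid E) y.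
pose q := p ∘ p1 - f ∘ p2.
have qi1 : q ∘ i1 = p by rewrite /q compBl -!compA e11 e21 compm1 compm0 subr0.
have [G [j hj]] := ab_kernel hC q.
have hq : epi q.
  apply: epi_of_cancel0 => c u uq0; apply: (epi_cancel0 (@ses_surj_epi _ _ E)).
  by rewrite -/p -qi1 compA uq0 comp0m.
have qj0 : q ∘ j = 0 by case: hj.
have pb : p ∘ (p1 ∘ j) = f ∘ (p2 ∘ j).
  by apply/eqP; rewrite -subr_eq0 !compA -compBl; apply/eqP.
(* If [u] kills the projection, then [u ∘ p2] factors through [q]; composing with [i1] shows that
   the factor [v] kills [p], so [v] is zero. *)
have he : epi (p2 ∘ j).
  apply: epi_of_cancel0 => c u; rewrite compA => u0.
  have [v hv] := cokernel_factor (epi_cokernel hq hj) u0.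
  have vp0 : v ∘ p = 0 by rewrite -qi1 compA hv -compA e21 compm0.
  have v0 := epi_cancel0 (@ses_surj_epi _ _ E) vp0.
  by rewrite -[u]compm1 -e22 compA -hv v0 !comp0m.
have [m hm] : exists m : hom d G, j ∘ m = i1 ∘ i.
  by apply: kernel_lift hj _; rewrite compA qi1 ses_surj_inj.
have hk : is_kernel (p2 ∘ j) m.
  apply: kernel_of_mono => [||t u].
  - by rewrite -compA hm compA e21 comp0m.
  - apply: mono_of_cancel0 => c u mu0; apply: (mono_cancel0 (@ses_inj_mono _ _ E)).
    by rewrite -/i -[i]comp1m -e11 -(compA p1) -hm -!compA mu0 !compm0.
  - rewrite -compA => e; have [v hv] : exists v : hom t d, i ∘ v = p1 ∘ j ∘ u.
      by apply: kernel_lift (ses_kernel E) _; rewrite compA pb -!compA e compm0.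
    exists v; apply: (kernel_mono hj); rewrite compA hm -compA hv.
    rewrite -[j ∘ u]comp1m -es compDl -!compA e compm0 addr0 //.
exists (epi_ses he hk), (p1 ∘ j); split=> //=.
by rewrite compm1 -compA hm compA e11 comp1m.
Qed.

(** This replaces the choice of preimages of elements: [f] lifts along [p] after passing to a cover
    [q], the base change of [p]. *)
Lemma epi_lift a b c (p : hom a b) (f : hom c b) : epi p ->
  exists c' (q : hom c' c) (f' : hom c' a), epi q /\ p ∘ f' = f ∘ q.
Proof.
move=> hp; have [k [i hi]] := ab_kernel hC p.
have [E [h [_ eh]]] := ses_pullback (epi_ses hp hi) f.
by exists (ses_mid E), (ses_surj E), h; split=> //; exact: ses_surj_epi.
Qed.

(* Exactness at [b] is self-dual: [im f = ker g] becomes [coker f = coim g]. *)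
Lemma exact_dual a b c k (f : hom a b) (g : hom b c) (i : hom k b) (q : hom a k) :
  is_kernel g i -> epi q -> i ∘ q = f ->
  exists k' (p : hom b k') (m : hom k' c), [/\ is_cokernel f p, mono m & m ∘ p = g].
Proof.
move=> hi hq ef; have [k' [p hp]] := ab_cokernel hC i.
have [m em] : exists m : hom k' c, m ∘ p = g.
  by apply: cokernel_factor hp _; case: hi.
exists k', p, m; split=> //.
- apply: cokernel_of_epi; first by rewrite -ef compA; case: hp => -> _; rewrite comp0m.
    exact: cokernel_epi hp.
  move=> t u; rewrite -ef compA => /(epi_cancel0 hq); exact: cokernel_factor hp.
- apply: mono_of_cancel0 => t u mu0.
  have [t' [e [u' [he e']]]] := epi_lift u (cokernel_epi hp).
  apply: (epi_cancel0 he); rewrite -e'.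
  have [w <-] : exists w : hom t' k, i ∘ w = u'.
    by apply: kernel_lift hi _; rewrite -em -compA e' compA mu0 comp0m.
  by rewrite compA; case: hp => -> _; rewrite comp0m.
Qed.

End ShortExact.

Lemma ses_pushout (C : precat) (hC : abelian C) (k d d' : C) (E : ses k d)
    (f : hom d d') :
  exists E' : ses k d', ses_mor (idm k) f E E'.
Proof.
have [E' [h [h1 h2]]] := @ses_pullback (op C) (abelian_op hC) _ _ _ (ses_op E) f.
by exists (ses_unop E'), h.
Qed.

(** * Yoneda extensions read as cocycles on partial resolutions *)

Section YonedaRefinement.
Variable C : precat.
Hypothesis hC : abelian C.
Implicit Types c d k x y z : C.

Lemma ses_mor_id c d (E : ses c d) : ses_mor (idm c) (idm d) E E.
Proof. by exists (idm _); rewrite !comp1m !compm1. Qed.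

Lemma ses_mor_comp c d c' d' c'' d'' (g : hom c c') (f : hom d d')
    (g' : hom c' c'') (f' : hom d' d'') (E : ses c d) (E' : ses c' d')
    (E'' : ses c'' d'') :
  ses_mor g f E E' -> ses_mor g' f' E' E'' -> ses_mor (g' ∘ g) (f' ∘ f) E E''.
Proof.
move=> [h [h1 h2]] [h' [h1' h2']]; exists (h' ∘ h); split.
  by rewrite -compA h1 compA h1' compA.
by rewrite compA h2' -compA h2 compA.
Qed.

Lemma yext_mor_id n c d (E : yext n.+1 c d) : yext_mor (idm c) (idm d) E E.
Proof.
elim: n d E => [|n IH] d E; first exact: ses_mor_id.
by exists (idm _); split; [exact: ses_mor_id | exact: IH].
Qed.

Lemma yext_mor_comp n c c' c'' d d' d'' (g : hom c c') (g' : hom c' c'')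
    (f : hom d d') (f' : hom d' d'') (E : yext n.+1 c d) (E' : yext n.+1 c' d')
    (E'' : yext n.+1 c'' d'') :
  yext_mor g f E E' -> yext_mor g' f' E' E'' ->
  yext_mor (g' ∘ g) (f' ∘ f) E E''.
Proof.
elim: n d d' d'' f f' E E' E'' => [|n IH] d d' d'' f f' E E' E''.
  exact: ses_mor_comp.
move=> [h [e1 e2]] [h' [e1' e2']]; exists (h' ∘ h).
by split; [exact: ses_mor_comp e1 e1' | exact: IH e2 e2'].
Qed.

Lemma yext_mor_comp1 n c d d' d'' (f : hom d d') (f' : hom d' d'')
    (E : yext n.+1 c d) (E' : yext n.+1 c d') (E'' : yext n.+1 c d'') :
  yext_mor (idm c) f E E' -> yext_mor (idm c) f' E' E'' ->
  yext_mor (idm c) (f' ∘ f) E E''.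
Proof. by move=> h h'; rewrite -[idm c](comp1m (idm c)); exact: yext_mor_comp h h'. Qed.

(** The term next to [d], of highest degree in the partial resolution. The match is forced:
    [yext n.+1] reduces only once [n] is known. *)
Definition ytop_mid n c d : yext n.+1 c d -> C :=
  match n return yext n.+1 c d -> C with
  | 0 => fun E => ses_mid E
  | _.+1 => fun E => ses_mid (projT2 E).1
  end.

Definition ytop_inj n c d : forall E : yext n.+1 c d, hom d (ytop_mid E) :=
  match n return forall E : yext n.+1 c d, hom d (ytop_mid E) with
  | 0 => fun E => ses_inj E
  | _.+1 => fun E => ses_inj (projT2 E).1
  end.

Lemma ytop_mor n c c' d d' (g : hom c c') (f : hom d d')
    (E : yext n.+1 c d) (E' : yext n.+1 c' d') :
  yext_mor g f E E' ->
  exists h : hom (ytop_mid E) (ytop_mid E'), h ∘ ytop_inj E = ytop_inj E' ∘ f.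
Proof.
case: n E E' => [|n] E E'; first by move=> [h [h1 _]]; exists h.
by move=> [_ [[h [h1 _]] _]]; exists h.
Qed.

Lemma ses_mor_mid c d c' d' (g : hom c c') (E : ses c d) (E' : ses c' d')
    (h : hom (ses_mid E) (ses_mid E')) :
  ses_surj E' ∘ h = g ∘ ses_surj E -> exists f, ses_mor g f E E'.
Proof. by move=> e; have [f hf] := ses_mor_ker e; exists f, h. Qed.

(** The map [e] is an identity in the construction; stating it as a map spares an equation between
    the objects [ses_mid E] and [a]. *)
Lemma epi_ses_ex a b (p : hom a b) : epi p ->
  exists k (E : ses b k) (e : hom (ses_mid E) a), ses_surj E = p ∘ e /\ epi e.
Proof.
move=> hp; have [k [i hi]] := ab_kernel hC p.
exists k, (epi_ses hC hp hi), (idm a); rewrite compm1; split=> // d u v.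
by rewrite !compm1.
Qed.

Lemma ses_refine_epi c d (E : ses c d) a (q : hom a (ses_mid E)) : epi q ->
  exists d' (E' : ses c d') (f : hom d' d) (e : hom (ses_mid E') a),
    ses_mor (idm c) f E' E /\ q ∘ e ∘ ses_inj E' = ses_inj E ∘ f.
Proof.
move=> hq; have [d' [E' [e [he _]]]] := epi_ses_ex (epi_comp (@ses_surj_epi _ _ _ E) hq).
have hh : ses_surj E ∘ (q ∘ e) = idm c ∘ ses_surj E' by rewrite comp1m he compA.
have [f hf] := ses_mor_ker hh.
by exists d', E', f, e; split; first by exists (q ∘ e).
Qed.

Lemma yext_refine_epi n c d (E : yext n.+1 c d) a (q : hom a (ytop_mid E)) :
  epi q ->
  exists d' (E' : yext n.+1 c d') (f : hom d' d) (e : hom (ytop_mid E') a),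
    yext_mor (idm c) f E' E /\ q ∘ e ∘ ytop_inj E' = ytop_inj E ∘ f.
Proof.
case: n E q => [|n] E q hq; first exact: ses_refine_epi hq.
case: E q hq => k [E1 E2] q /ses_refine_epi [d' [E' [f [e [h1 h2]]]]].
exists d', (existT _ k (E', E2)), f, e; split=> //.
by exists (idm k); split=> //=; exact: yext_mor_id.
Qed.

(** After base change of both sequences to [y], an object [c] over both middle terms still maps onto
    [y]; the kernel of that epimorphism maps to [z] and to [d]. *)
Lemma ses_common_refinement y k k' z d (a : hom y k) (b : hom y k')
    (F : ses k z) (E : ses k' d) :
  exists y' (G : ses y y') (f : hom y' z) (g : hom y' d),
    ses_mor a f G F /\ ses_mor b g G E.
Proof.
have [F1 [u [_ hu]]] := ses_pullback hC F a.
have [E1 [v [_ hv]]] := ses_pullback hC E b.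
have [c [q [q' [hq eq]]]] := epi_lift hC (ses_surj F1) (@ses_surj_epi _ _ _ E1).
have [y' [G [e [he _]]]] := epi_ses_ex (epi_comp (@ses_surj_epi _ _ _ F1) hq).
have [f hf] : exists f, ses_mor a f G F.
  by apply: (@ses_mor_mid _ _ _ _ _ _ _ (u ∘ q ∘ e)); rewrite !compA hu he !compA.
have [g hg] : exists g, ses_mor b g G E.
  apply: (@ses_mor_mid _ _ _ _ _ _ _ (v ∘ q' ∘ e)).
  by rewrite !compA hv he -eq !compA.
by exists y', G, f, g.
Qed.

Lemma yext_common_refinement n c z d (F : yext n.+1 c z) (E : yext n.+1 c d) :
  exists y (G : yext n.+1 c y) (f : hom y z) (g : hom y d),
    yext_mor (idm c) f G F /\ yext_mor (idm c) g G E.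
Proof.
elim: n z d F E => [|n IH] z d F E; first exact: ses_common_refinement.
case: F E => k [F1 F2] [k' [E1 E2]].
have [y [G [a [b [ha hb]]]]] := IH _ _ F2 E2.
have [y' [G1 [f [g [hf hg]]]]] := ses_common_refinement a b F1 E1.
exists y', (existT _ y (G1, G)), f, g.
by split; [exists a | exists b].
Qed.

(* Two morphisms over the identity are homotopic after a refinement; as [d] is
   the last term, the homotopy exhibits the difference of the end maps as an
   extension to [ytop_mid]. *)
Lemma yext_homotopy n c z d (F : yext n.+1 c z) (E : yext n.+1 c d)
    (f1 f2 : hom z d) :
  yext_mor (idm c) f1 F E -> yext_mor (idm c) f2 F E ->
  exists y (G : yext n.+1 c y) (g : hom y z) (s : hom (ytop_mid G) d),
    yext_mor (idm c) g G F /\ s ∘ ytop_inj G = (f1 - f2) ∘ g.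
Proof.
elim: n z d F E f1 f2 => [|n IH] z d F E f1 f2.
  move=> [u1 [i1 p1]] [u2 [i2 p2]].
  have [s hs] : exists s, ses_inj E ∘ s = u1 - u2.
    by apply: kernel_lift (ses_kernel E) _; rewrite compBr p1 p2 subrr.
  exists z, F, (idm z), s; split; first exact: ses_mor_id.
  apply: (@ses_inj_mono _ _ _ E).
  by rewrite compA hs compm1 compBl compBr i1 i2.
case: F E => k [F1 F2] [k' [E1 E2]] [a1 [/= [u1 [i1 p1]] h1]] [a2 [/= [u2 [i2 p2]] h2]].
have [y0 [G0 [g0 [s0 [hG0 hs0]]]]] := IH _ _ _ _ _ _ h1 h2.
(* The earlier homotopy [s0] lands in [k']. Lifting it along [ses_surj E1] requires a cover of the
   top term of [G0], hence the refinement [G1]. *)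
have [H [q [s1 [hq hs1]]]] := epi_lift hC s0 (@ses_surj_epi _ _ _ E1).
have [y1 [G1 [g1 [e [hG1 he]]]]] := yext_refine_epi hq.
have [G [v [iv pv]]] := ses_pullback hC F1 (g0 ∘ g1).
(* As for chain homotopies, the earlier homotopy composed with the differential is subtracted; the
   result is killed by [ses_surj E1] and so comes from [d]. *)
pose w := (u1 - u2) ∘ v - s1 ∘ e ∘ ytop_inj G1 ∘ ses_surj G.
have [t ht] : exists t, ses_inj E1 ∘ t = w.
  apply: kernel_lift (ses_kernel E1) _; rewrite /w compBr !compA hs1.
  rewrite -(compA s0) -(compA s0) he compA hs0 compBr p1 p2 -compBl -!compA pv.
  by rewrite !compA subrr.
exists z, (existT _ y1 (G, G1)), (idm z), t; split.
  exists (g0 ∘ g1); split=> /=; first by exists v.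
  exact: yext_mor_comp1 hG1 hG0.
apply: (@ses_inj_mono _ _ _ E1); rewrite /= compA ht /w compBl -!compA.
by rewrite ses_surj_inj !compm0 subr0 iv !compm1 compBl compBr i1 i2.
Qed.

(* With [F] read as a partial resolution of [x], a map [f : z -> d] is a
   cocycle of degree [n.+1] on it; effaceable cocycles become coboundaries
   after refining the resolution. *)
Definition effaceable n x z d (F : yext n.+1 x z) (f : hom z d) : Prop :=
  exists y (G : yext n.+1 x y) (g : hom y z) (s : hom (ytop_mid G) d),
    yext_mor (idm x) g G F /\ s ∘ ytop_inj G = f ∘ g.

Definition cocycles_efface n x d : Prop :=
  forall z (F : yext n.+1 x z) (f : hom z d), effaceable F f.

(* The class of [E] is zero. *)
Definition yext_trivial n x d (E : yext n.+1 x d) : Prop :=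
  forall z (F : yext n.+1 x z) (f : hom z d),
    yext_mor (idm x) f F E -> effaceable F f.

(** From [E'] to [E], compose. Conversely, on a common refinement of [F] and [E] the two morphisms
    to [E'] are homotopic, so the cocycle from [F] is the one from [E], which is effaceable, plus a
    coboundary. *)
Lemma yext_trivial_mor n x d (E E' : yext n.+1 x d) :
  yext_mor (idm x) (idm d) E E' -> yext_trivial E <-> yext_trivial E'.
Proof.
move=> hE; split=> h z F f hf; last first.
  by apply: h; rewrite -[f]comp1m; exact: yext_mor_comp1 hf hE.
have [y0 [G0 [a [b [ha hb]]]]] := yext_common_refinement F E.
have h1 : yext_mor (idm x) (f ∘ a) G0 E' by exact: yext_mor_comp1 ha hf.
have h2 : yext_mor (idm x) b G0 E'.
  by rewrite -[b]comp1m; exact: yext_mor_comp1 hb hE.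
have [y1 [G1 [g [s [hg hs]]]]] := yext_homotopy h1 h2.
have [y2 [G2 [g' [t [hg' ht]]]]] := h _ _ _ (yext_mor_comp1 hg hb).
have [u hu] := ytop_mor hg'.
exists y2, G2, (a ∘ g ∘ g'), (s ∘ u + t); split.
  by apply: yext_mor_comp1 hg' _; exact: yext_mor_comp1 hg ha.
by rewrite compDl -compA hu compA hs ht compBl compBl subrK !compA.
Qed.

(** If [ytop_inj E] has a retraction, every cocycle given by a morphism to [E] extends to the top
    term. Such an [E] is a split sequence spliced with any extension of lower degree. *)
Lemma yext_trivial_ex n x d : exists E : yext n.+1 x d, yext_trivial E.
Proof.
have extends z (F : yext n.+1 x z) (f : hom z d) (s : hom (ytop_mid F) d) :
    s ∘ ytop_inj F = f -> effaceable F f.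
  by exists z, F, (idm z), s; rewrite compm1; split=> //; exact: yext_mor_id.
suff [E hE] : exists E : yext n.+1 x d,
    exists r : hom (ytop_mid E) d, r ∘ ytop_inj E = idm d.
  case: hE => r hr; exists E => z F f /ytop_mor [h hh].
  by apply: (@extends _ _ _ (r ∘ h)); rewrite -compA hh compA hr comp1m.
move=> {extends}; have split_ses y k : exists (E : ses k y) (r : hom (ses_mid E) y),
    r ∘ ses_inj E = idm y.
  have [s [i1 [i2 [p1 [p2 [e11 e22 e12 e21 es]]]]]] := ab_biproduct hC y k.
  have hp : epi p2 by move=> c u v; move/(congr1 (fun w => w ∘ i2)); rewrite -!compA e22 !compm1.
  suff hk : is_kernel p2 i1 by exists (epi_ses hC hp hk), p1.
  apply: kernel_of_mono => // [c u v|t u hu].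
    by move/(congr1 (fun w => p1 ∘ w)); rewrite !compA e11 !comp1m.
  by exists (p1 ∘ u); rewrite -[RHS]comp1m -es compDl -!compA hu compm0 addr0.
elim: n d => [|n IH] d; first exact: split_ses.
have [z _] := ab_zero hC; have [E [r hr]] := split_ses d z; have [E' _] := IH z.
by exists (existT _ z (E, E')), r.
Qed.

Lemma yext_pushout n x z d (F : yext n.+1 x z) (f : hom z d) :
  exists E : yext n.+1 x d, yext_mor (idm x) f F E.
Proof.
case: n F => [|n] F; first exact: ses_pushout.
case: F => k [F1 F2]; have [E hE] := ses_pushout hC F1 f.
by exists (existT _ k (E, F2)), (idm k); split=> //; exact: yext_mor_id.
Qed.

(** The cocycle [f] underlies the morphism from [F] to its pushout [E], so it is effaceable once [E]
    is trivial. Triviality passes along Yoneda equivalence from the trivial extension [E0]. *)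
Lemma ext_vanishes_efface n x d : ext_vanishes n.+1 x d -> cocycles_efface n x d.
Proof.
move=> hv z F f; have [E hE] := yext_pushout F f; apply: (_ : yext_trivial E) hE.
have [E0 hE0] := yext_trivial_ex n x d.
suff [] : yext_trivial E0 <-> yext_trivial E by move=> h _; exact: h.
elim: (hv E0 E) => [E1 E2 /yext_trivial_mor //|//|E1 E2 _ []|E1 E2 E3 _ [h1 h2] _ [h3 h4]].
  by split.
by split=> h; [apply: h3; apply: h1 | apply: h2; apply: h4].
Qed.

Lemma cocycles_efface_zero n x d : is_zero d -> cocycles_efface n x d.
Proof.
move=> hd z F f; exists z, F, (idm z), 0; split; first exact: yext_mor_id.
exact: hom_to_zero.
Qed.

(* Pulling [E] back along a cocycle with values in [k] turns it into a cocycle of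
   one degree higher with values in [d]. *)
Lemma cocycles_efface_ses n x k d (E : ses k d) :
  cocycles_efface n x (ses_mid E) -> cocycles_efface n.+1 x d ->
  cocycles_efface n x k.
Proof.
move=> hm hd z F f; have [E' [h [hi hs]]] := ses_pullback hC E f.
have [y [G [g [s [hG es]]]]] := hd _ (existT _ z (E', F)) (idm d).
case: G hG s es => y1 [G1 G2] [a [/= [v [iv pv]] hG2]] s es.
(* The two maps agree on [y], so their difference descends to [y1], where it lifts [f ∘ a] to a
   cocycle with values in [ses_mid E]. *)
have [b hb] : exists b : hom y1 (ses_mid E), b ∘ ses_surj G1 = h ∘ v - ses_inj E ∘ s.
  apply: cokernel_factor (ses_cokernel G1) _.
  by rewrite compBl -!compA iv es comp1m compA hi compm1 subrr.
have ebs : ses_surj E ∘ b = f ∘ a.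
  apply: (@ses_surj_epi _ _ _ G1); rewrite -compA hb compBr !compA ses_surj_inj.
  by rewrite comp0m subr0 hs -!compA pv.
have [y2 [G3 [c [t [hG3 ht]]]]] := hm _ G2 b.
exists y2, G3, (a ∘ c), (ses_surj E ∘ t); split; first exact: yext_mor_comp1 hG3 hG2.
by rewrite -compA ht compA ebs compA.
Qed.

(** The pullback of [E] along [f] is the obstruction to lifting [f]; effacing it gives a map on a
    cover of [x] that descends to [x]. *)
Lemma efface_ses_lift x k d (E : ses k d) (f : hom x k) :
  cocycles_efface 0 x d -> exists g : hom x (ses_mid E), ses_surj E ∘ g = f.
Proof.
move=> hd; have [E' [h [hi hs]]] := ses_pullback hC E f.
have [y [G [g [s [[v [iv pv]] es]]]]] := hd _ E' (idm d).
have [b hb] : exists b : hom x (ses_mid E), b ∘ ses_surj G = h ∘ v - ses_inj E ∘ s.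
  apply: cokernel_factor (ses_cokernel G) _.
  by rewrite compBl -!compA iv es comp1m compA hi compm1 subrr.
exists b; apply: (@ses_surj_epi _ _ _ G); rewrite -compA hb compBr !compA.
by rewrite ses_surj_inj comp0m subr0 hs -!compA pv comp1m.
Qed.

End YonedaRefinement.

(** * Yoneda extensions in the opposite category *)

Section YonedaDual.

(** [yext] grows at the end [d]; reversal exchanges the ends, so it needs a splice at the end
    [c]. *)
Fixpoint ysnoc (D : precat) n (c k d : D) (e : ses c k) {struct n} :
    yext n.+1 k d -> yext n.+2 c d :=
  match n return yext n.+1 k d -> yext n.+2 c d with
  | 0 => fun E => existT _ k (E, e)
  | m.+1 => fun E => existT _ (projT1 E) ((projT2 E).1, ysnoc e (projT2 E).2)
  end.

Lemma ysnoc_mor (D : precat) n (c k d c' k' d' : D) (g : hom c c') (h : hom k k')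
    (f : hom d d') (e : ses c k) (e' : ses c' k') (E : yext n.+1 k d)
    (E' : yext n.+1 k' d') :
  ses_mor g h e e' -> yext_mor h f E E' ->
  yext_mor g f (ysnoc e E) (ysnoc e' E').
Proof.
move=> he; elim: n d d' f E E' => [|n IH] d d' f E E'; first by exists h.
by move=> [a [h1 h2]]; exists a; split=> //; exact: IH.
Qed.

Lemma ysnoc_surj (D : precat) n (c d : D) (E : yext n.+2 c d) :
  exists (k : D) (e : ses c k) (E' : yext n.+1 k d), ysnoc e E' = E.
Proof.
elim: n d E => [|n IH] d [k [E1 E2]]; first by exists k, E2, E1.
have [k' [e [E' <-]]] := IH _ E2.
by exists k', e, (existT _ k (E1, E')).
Qed.

Variable C : precat.
Implicit Types c d : C.

Fixpoint yext_op n c d {struct n} : yext n.+1 c d -> @yext (op C) n.+1 d c :=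
  match n return yext n.+1 c d -> @yext (op C) n.+1 d c with
  | 0 => fun E => ses_op E
  | m.+1 => fun E => @ysnoc (op C) m d (projT1 E) c (ses_op (projT2 E).1)
                       (yext_op (projT2 E).2)
  end.

Lemma yext_op_mor n c d c' d' (g : hom c c') (f : hom d d') (E : yext n.+1 c d)
    (E' : yext n.+1 c' d') :
  yext_mor g f E E' -> @yext_mor (op C) _ _ _ _ _ f g (yext_op E') (yext_op E).
Proof.
elim: n d d' f E E' => [|n IH] d d' f E E'; first exact: ses_mor_op.
move=> [h [h1 h2]].
apply: (@ysnoc_mor (op C) n _ _ _ _ _ _ f h g); last exact: IH h2.
exact: ses_mor_op.
Qed.

Lemma yext_op_surj n c d (E : @yext (op C) n.+1 d c) :
  exists E' : yext n.+1 c d, yext_op E' = E.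
Proof.
elim: n d E => [|n IH] d E.
  by exists (ses_unop E); case: E.
have [k [e [E1 <-]]] := ysnoc_surj E; have [E2 <-] := IH _ E1.
by exists (existT _ k (ses_unop e, E2)); case: e.
Qed.

(** Every opposite extension is a reversal by [yext_op_surj], and reversal turns morphisms around,
    which a symmetric relation absorbs. *)
Lemma ext_vanishes_op n c d :
  ext_vanishes n.+1 c d -> @ext_vanishes (op C) n.+1 d c.
Proof.
move=> hv E E'; have [F <-] := yext_op_surj E; have [F' <-] := yext_op_surj E'.
elim: (hv F F') => [F1 F2 /yext_op_mor|F1|F1 F2 _|F1 F2 F3 _ h1 _ h2].
- by move=> h; apply: rst_sym; exact: rst_step.
- exact: rst_refl.
- exact: rst_sym.
- exact: rst_trans h1 h2.
Qed.

Lemma perp_op (S T : C -> Prop) : perp S T -> @perp (op C) T S.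
Proof. by move=> h c d hc hd [//|i] _; apply: ext_vanishes_op; exact: h. Qed.

End YonedaDual.

(** * Augmented sequences, dimension shifting and the comparison theorem *)

Section AugmentedSequences.
Variable C : precat.

(** One notion serves resolutions in [C] and coresolutions read in [op C]; indexing by naturals lets
    lifts be built by recursion. *)
Record augseq (M : C) := AugSeq {
  sq :> nat -> C;
  sq_aug : hom (sq 0) M;
  sq_d : forall n, hom (sq n.+1) (sq n);
  sq_aug_d : sq_aug ∘ sq_d 0 = 0;
  sq_dd : forall n, sq_d n ∘ sq_d n.+1 = 0 }.

Definition sq_tgt M (A : augseq M) n : C := if n is m.+1 then A m else M.

Definition sq_out M (A : augseq M) n : hom (A n) (sq_tgt A n) :=
  match n with 0 => sq_aug A | m.+1 => sq_d A m end.

Lemma sq_out_d M (A : augseq M) n : sq_out A n ∘ sq_d A n = 0.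
Proof. by case: n => [|n]; [exact: sq_aug_d | exact: sq_dd]. Qed.

Definition sq_exact M (A : augseq M) : Prop :=
  epi (sq_aug A) /\
  forall n, exists (K : C) (i : hom K (A n)) (p : hom (A n.+1) K),
    [/\ is_kernel (sq_out A n) i, epi p & i ∘ p = sq_d A n].

Definition hom_exact c M (A : augseq M) : Prop :=
  (forall a : hom c M, exists b, sq_aug A ∘ b = a) /\
  forall n (a : hom c (A n)), sq_out A n ∘ a = 0 -> exists b, sq_d A n ∘ b = a.

Lemma sq_exact_epi M (A : augseq M) n K (i : hom K (A n)) :
  sq_exact A -> is_kernel (sq_out A n) i ->
  exists p, epi p /\ i ∘ p = sq_d A n.
Proof.
move=> [_ /(_ n) [K' [i' [p' [hi' hp' e']]]]] hi.
have [p hp] : exists p, i ∘ p = sq_d A n by exact: kernel_lift hi (sq_out_d A n).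
have [v hv] : exists v, i ∘ v = i' by apply: kernel_lift hi _; case: hi'.
have [w hw] : exists w, i' ∘ w = i by apply: kernel_lift hi' _; case: hi.
have vw : v ∘ w = idm K by apply: (kernel_mono hi); rewrite compA hv hw compm1.
have pv : p = v ∘ p' by apply: (kernel_mono hi); rewrite hp compA hv.
exists p; split=> //; rewrite pv; apply: epi_comp hp' => c a b.
by move/(congr1 (fun u => u ∘ w)); rewrite -!compA vw !compm1.
Qed.

Lemma zero_of_mono (a b : C) (f : hom a b) : mono f -> is_zero b -> is_zero a.
Proof.
move=> hf hb; have e : idm a = 0 by apply: hf; exact: hom_to_zero.
by move=> c; split=> u v; [rewrite -[u]compm1 -[v]compm1 | rewrite -[u]comp1m -[v]comp1m];
  rewrite e ?compm0 ?comp0m.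
Qed.

(** Each syzygy [K] is the quotient of [A n.+1] by the next syzygy, and extensions of [x] by
    [A n.+1] vanish. Shifting past the bound [b] reaches a zero syzygy, so cocycles in all syzygies
    efface. *)
Lemma bounded_hom_exact (hC : abelian C) (W : C -> Prop) x M (A : augseq M) b :
  sq_exact A -> (forall n, W (A n)) -> (forall n, (b <= n)%N -> is_zero (A n)) ->
  (forall w, W w -> forall n, ext_vanishes n.+1 x w) -> hom_exact x A.
Proof.
move=> hA hW hb hx.
(* Descending induction on [n], with [m] bounding the distance to [b]; [j] stays general because
   each shift raises it. *)
have syzygy m n K (i : hom K (A n)) j : (b <= n + m)%N ->
    is_kernel (sq_out A n) i -> cocycles_efface j x K.
  elim: m n K i j => [|m IH] n K i j hm hi.
    apply: cocycles_efface_zero; apply: zero_of_mono (kernel_mono hi) (hb _ _).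
    by rewrite -[n]addn0.
  have [p [hp ep]] := sq_exact_epi hA hi; have [K' [i' hi']] := ab_kernel hC p.
  apply: (cocycles_efface_ses hC (E := epi_ses hC hp hi')) => /=.
    exact: (ext_vanishes_efface hC (hx _ (hW _) _)).
  apply: (IH n.+1 _ i'); first by rewrite addSnnS.
  apply: kernel_of_mono (kernel_mono hi') _ => /=.
    by rewrite -ep -compA; case: hi' => -> _; rewrite compm0.
  move=> t u; rewrite -ep -compA => /(mono_cancel0 (kernel_mono hi)).
  exact: kernel_lift hi'.
have syzygy0 n K (i : hom K (A n)) : is_kernel (sq_out A n) i -> cocycles_efface 0 x K.
  exact/syzygy/leq_addl.
have lift a k (p : hom a k) (f : hom x k) : epi p ->
    (forall K (i : hom K a), is_kernel p i -> cocycles_efface 0 x K) ->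
    exists g, p ∘ g = f.
  move=> hp hK; have [K [i hi]] := ab_kernel hC p.
  exact: (efface_ses_lift hC (epi_ses hC hp hi) f (hK _ _ hi)).
split=> [a|n a ha]; first by apply: lift; [case: hA | exact: (syzygy0 0)].
have [K [i [_ [hi _ _]]]] := hA.2 n; have [p [hp ep]] := sq_exact_epi hA hi.
(* A cycle factors through the syzygy [K]; lifting it along [A n.+1 -> K] is obstructed only by the
   next syzygy. *)
have [a' ha'] := kernel_lift hi ha.
have [g hg] : exists g, p ∘ g = a'.
  apply: lift => // K' i' hi'; apply: (syzygy0 n.+1 _ i').
  apply: kernel_of_mono (kernel_mono hi') _ => /=.
    by rewrite -ep -compA; case: hi' => -> _; rewrite compm0.
  move=> t u; rewrite -ep -compA => /(mono_cancel0 (kernel_mono hi)).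
  exact: kernel_lift hi'.
by exists g; rewrite -ep -compA hg.
Qed.

Section Comparison.
Variable M : C.
Implicit Types A B P Q : augseq M.

Definition sq_lifts_id A B (f : forall n, hom (A n) (B n)) : Prop :=
  sq_aug B ∘ f 0 = sq_aug A /\
  forall n, f n ∘ sq_d A n = sq_d B n ∘ f n.+1.

(** Each degree has its own pair [s], [s'], with no coherence between degrees: weaker than a null
    homotopy, but enough to compare homology degree by degree. *)
Definition sq_null A B (u : forall n, hom (A n) (B n)) : Prop :=
  (exists s, u 0 = sq_d B 0 ∘ s) /\
  forall n, exists (s : hom (A n) (B n.+1)) s',
    u n.+1 = sq_d B n.+1 ∘ s' + s ∘ sq_d A n.

Lemma sq_lift A B : (forall n, hom_exact (A n) B) ->
  exists f : forall n, hom (A n) (B n), sq_lifts_id f.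
Proof.
(* The recursion carries the fact that [f ∘ sq_d A n] is a cycle, which the next lift requires. *)
move=> h; pose T n := {f : hom (A n) (B n) | sq_out B n ∘ f ∘ sq_d A n = 0}.
have next n (f : T n) :
    {f' : T n.+1 | sval f ∘ sq_d A n = sq_d B n ∘ sval f'}.
  case: f => f hf /=; apply: cid.
  have [f' hf'] : exists f', sq_d B n ∘ f' = f ∘ sq_d A n.
    by apply: (h n.+1).2; rewrite compA.
  suff e : sq_out B n.+1 ∘ f' ∘ sq_d A n.+1 = 0 by exists (exist _ f' e).
  by rewrite /= hf' -compA sq_dd compm0.
have [f0 hf0] := (h 0).1 (sq_aug A).
have e0 : sq_out B 0 ∘ f0 ∘ sq_d A 0 = 0 by rewrite /= hf0 sq_aug_d.
pose F := nat_rect T (exist _ f0 e0) (fun n f => sval (next n f)).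
exists (fun n => sval (F n)); split=> // n; exact: (svalP (next n (F n))).
Qed.

Lemma sq_homotopy A B (u : forall n, hom (A n) (B n)) :
  (forall n, hom_exact (A n) B) -> sq_aug B ∘ u 0 = 0 ->
  (forall n, u n ∘ sq_d A n = sq_d B n ∘ u n.+1) -> sq_null u.
Proof.
move=> h u0 hu.
have step n (s : hom (A n) (B n.+1)) :
    sq_d B n ∘ s ∘ sq_d A n = u n ∘ sq_d A n ->
    exists s', u n.+1 = sq_d B n.+1 ∘ s' + s ∘ sq_d A n.
  move=> hs; have [|s' hs'] := (h n.+1).2 n.+1 (u n.+1 - s ∘ sq_d A n).
    by rewrite /= compBr compA hs hu subrr.
  by exists s'; rewrite hs' subrK.
have [s0 hs0] := (h 0).2 0 (u 0) u0.
split; first by exists s0.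
(* The [s'] of one degree serves as [s] in the next, and its equation supplies the premise of
   [step]. *)
elim=> [|n [s [s' hs]]].
  have [|s1 hs1] := step 0 s0; first by rewrite hs0.
  by exists s0, s1.
have [|s'' hs''] := step n.+1 s'; last by exists s', s''.
by rewrite hs compDl -!compA sq_dd compm0 addr0.
Qed.

(** The inverse is a lift [Q -> B -> P]. Both composites with [f] lift the identity of [M], so
    [sq_homotopy] compares them with identities. *)
Lemma sq_inverse P Q B (f : forall n, hom (P n) (Q n)) :
  (forall n, hom_exact (Q n) B) -> (forall n, hom_exact (B n) P) ->
  (forall n, hom_exact (P n) P) -> (forall n, hom_exact (Q n) Q) ->
  sq_lifts_id f ->
  exists k : forall n, hom (Q n) (P n), sq_lifts_id k /\
    sq_null (fun n => k n ∘ f n - idm (P n)) /\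
    sq_null (fun n => f n ∘ k n - idm (Q n)).
Proof.
move=> hQB hBP hPP hQQ [f0 fd].
have [g [g0 gd]] := sq_lift hQB; have [l [l0 ld]] := sq_lift hBP.
pose k n := l n ∘ g n.
have k0 : sq_aug P ∘ k 0 = sq_aug Q by rewrite /k compA l0.
have kd n : k n ∘ sq_d Q n = sq_d P n ∘ k n.+1.
  by rewrite /k -compA gd !compA ld.
clearbody k; exists k; do 2!split=> //; apply: sq_homotopy => // [|n].
- by rewrite compBr compA k0 f0 compm1 subrr.
- by rewrite compBr compBl comp1m compm1 -compA fd !compA kd.
- by rewrite compBr compA f0 k0 compm1 subrr.
- by rewrite compBr compBl comp1m compm1 -compA kd !compA fd.
Qed.

End Comparison.

End AugmentedSequences.

(** * Exactness and homology of complexes of abelian groups *)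

(** Neighbouring degrees are variables with equations, so that concrete indices such as [Negz 0] fit
    by computation. *)
Lemma zexactP (G : zcomplex) :
  zexact G <->
  forall n j k : int, j = n - 1 -> k = n + 1 ->
    forall x : G n, zd G n j x = 0 -> exists y : G k, zd G k n y = x.
Proof.
split=> [h n _ _ -> -> x hx|h n u].
  have hz : x \in @zcycle G n by apply/eqP.
  have e := h n (\pi_(zhomology G n)%qT (ZCycle hz)).
  have : ZCycle hz - 0 \in @zboundary G n.
    by rewrite Quotient.idealrBE e raddf0.
  by rewrite subr0 unfold_in => /asboolP.
rewrite -[u]reprK; set x := repr u.
have hx : zd G n (n - 1) (val x) = 0 by apply/eqP; exact: (valP x).
have [y hy] := h n _ _ erefl erefl _ hx.
rewrite -[RHS](raddf0 (\pi_(zhomology G n)%qT)); apply/eqP.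
by rewrite -Quotient.idealrBE subr0 unfold_in; apply/asboolP; exists y.
Qed.

Lemma zhomology_mapK (G K : zcomplex) (f : zchain_map G K) (g : zchain_map K G) n :
  (forall x : G n, zd G n (n - 1) x = 0 ->
    exists y, zd G (n + 1) n y = g n (f n x) - x) ->
  forall u, zhomology_map g n (zhomology_map f n u) = u.
Proof.
move=> h u; rewrite -[u]reprK; set x := repr u.
rewrite (zhomology_map_pi f) (zhomology_map_pi g); apply/eqP.
rewrite -Quotient.idealrBE unfold_in; apply/asboolP => /=.
by apply: h; apply/eqP; exact: (valP x).
Qed.

(** * Degreewise null homotopies and their effect on homology *)

Section DegreewiseNull.
Variable C : precat.

Definition cx_null (X Y : complex C) (i : int) (u : hom (X i) (Y i)) : Prop :=
  exists (j l : int) (s : hom (X i) (Y j)) (s' : hom (X l) (Y i)),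
    [/\ j = i + 1, l = i - 1 & u = cd Y j i ∘ s + s' ∘ cd X i l].

Lemma homXN_null (X : complex C) (N : C) m (u : hom (X (- m)) (X (- m)))
    (x : homXN X N m) :
  cx_null u -> zd (homXN X N) m (m - 1) x = 0 ->
  exists y, zd (homXN X N) (m + 1) m y = x ∘ u.
Proof.
move=> [j [l [s [s' [ej el ->]]]]] hx.
have {}ej : j = - (m - 1) by rewrite ej opprB addrC.
have {}el : l = - (m + 1) by rewrite el opprD.
subst j l; exists (x ∘ s'); rewrite /= /precomp compDr !compA.
by rewrite (hx : x ∘ cd X _ _ = 0) comp0m add0r.
Qed.

Lemma homMX_null (X : complex C) (M : C) m (u : hom (X m) (X m))
    (x : homMX M X m) :
  cx_null u -> zd (homMX M X) m (m - 1) x = 0 ->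
  exists y, zd (homMX M X) (m + 1) m y = u ∘ x.
Proof.
move=> [j [l [s [s' [ej el ->]]]]] hx; subst j l.
exists (s ∘ x); rewrite /= /postcomp compDl -!compA.
by rewrite (hx : cd X _ _ ∘ x = 0) compm0 addr0.
Qed.

(** The inverse is induced by [k]. Since Hom into [N] is contravariant, the homotopy on [Q] makes it
    a left inverse and the one on [P] a right inverse. *)
Lemma theta_res_iso (S T : subcat C) (M : C) (P : resolution S M)
    (Q : resolution T M) (f : chain_map P Q) (k : chain_map Q P) :
  (forall i, cx_null (k i ∘ f i - idm (P i))) ->
  (forall i, cx_null (f i ∘ k i - idm (Q i))) ->
  forall n, is_nat_iso (theta_res f n).
Proof.
move=> hP hQ n; exists (theta_res k n) => N; split=> x.
  apply: zhomology_mapK => y hy; have [z hz] := homXN_null (hQ _) hy.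
  by exists z; rewrite hz compBr compm1 compA.
apply: zhomology_mapK => y hy; have [z hz] := homXN_null (hP _) hy.
by exists z; rewrite hz compBr compm1 compA.
Qed.

Lemma theta_cores_iso (S T : subcat C) (N : C) (P : coresolution S N)
    (Q : coresolution T N) (f : chain_map P Q) (k : chain_map Q P) :
  (forall i, cx_null (k i ∘ f i - idm (P i))) ->
  (forall i, cx_null (f i ∘ k i - idm (Q i))) ->
  forall n, is_nat_iso (theta_cores f n).
Proof.
move=> hP hQ n; exists (theta_cores k n) => M; split=> x.
  apply: zhomology_mapK => y hy; have [z hz] := homMX_null (hP _) hy.
  by exists z; rewrite hz compBl comp1m -compA.
apply: zhomology_mapK => y hy; have [z hz] := homMX_null (hQ _) hy.
by exists z; rewrite hz compBl comp1m -compA.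
Qed.

Lemma homology_vanishes_exact (X : complex C) n j k :
  homology_vanishes X n -> j = n - 1 -> k = n + 1 ->
  exists (Z : C) (z : hom Z (X n)) (b : hom (X k) Z),
    [/\ is_kernel (cd X n j) z, epi b & z ∘ b = cd X k n].
Proof.
move=> [Z [H [z [p [[hz [b [hb hp]]] hH]]]]] -> ->; exists Z, z, b; split=> //.
apply: epi_of_cancel0 => c u /(cokernel_factor hp) [v <-].
by rewrite (hom_to_zero p 0 hH) compm0.
Qed.

End DegreewiseNull.

(** * Resolutions as augmented sequences *)

Lemma posz_pred n : Posz n = Posz n.+1 - 1.
Proof. by rewrite -addn1 PoszD addrK. Qed.

Lemma posz_succ n : Posz n.+1 = Posz n + 1.
Proof. by rewrite -addn1 PoszD. Qed.

Lemma negz_pred n : Negz n.+1 = Negz n - 1.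
Proof. by rewrite !NegzE -[n.+2]addn1 PoszD opprD. Qed.

Section ResolutionSequences.
Variables (C : precat) (S : subcat C) (M : C).
Implicit Types X : resolution S M.

Definition res_seq X : augseq M :=
  @AugSeq C M (fun n => X (Posz n)) (res_aug X)
    (fun n => cd X (Posz n.+1) (Posz n)) (res_aug_d X _)
    (fun n => cd_cd X _ _ _).

Lemma res_seq_exact (hC : abelian C) X : sq_exact (res_seq X).
Proof.
have [Z [z [hz [b [hb hp]]]]] := res_H0 X.
(* The term in degree -1 is zero, so the cycle inclusion [z] is an isomorphism and [res_aug] is a
   cokernel because [res_aug ∘ z] is. *)
have [v hv] : exists v, z ∘ v = idm (X 0).
  by apply: kernel_lift hz _; apply: hom_to_zero; exact: res_neg.
have haug : is_cokernel (cd X 1 0) (res_aug X).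
  apply: cokernel_of_epi; first exact: res_aug_d.
    apply: epi_of_cancel0 => c u u0; apply: (epi_cancel0 (cokernel_epi hp)).
    by rewrite compA u0 comp0m.
  move=> t u; rewrite -hb compA => /(cokernel_factor hp) [w hw]; exists w.
  by rewrite -[u]compm1 -hv compA -hw -!compA hv compm1.
split=> [|[|n]]; first exact: cokernel_epi haug.
  (* In the opposite category [res_aug] is a kernel; dualizing exactness there shows that the first
     differential maps onto the kernel of [res_aug]. *)
  have hid : @epi (op C) _ _ (idm M) by move=> c u w /=; rewrite !comp1m.
  have [] := @exact_dual (op C) (abelian_op hC) _ _ _ _ (res_aug X) (cd X 1 0)
    (res_aug X) (idm M) haug hid (@compm1 (op C) _ _ _).
  by move=> K [i [p [hi hm e]]]; exists K, i, p.
by apply: homology_vanishes_exact (posz_pred n) (posz_succ n.+1); exact: res_acyclic.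
Qed.

Lemma proper_resP X :
  proper_res X <-> forall c, S c -> hom_exact c (res_seq X).
Proof.
split=> h c hc.
  have {}h := (zexactP _).1 (h c hc); split=> [a|[|n] a ha].
  - exact: (h (Negz 0) (Negz 1) (Posz 0) erefl erefl a (comp0m _ _)).
  - exact: (h (Posz 0) (Negz 0) (Posz 1) erefl erefl a ha).
  - exact: (h (Posz n.+1) (Posz n) (Posz n.+2) (posz_pred n) (posz_succ n.+1) a ha).
have [h0 hn] := h c hc; apply/zexactP => -[[|n]|[|n]] j k -> -> x hx.
- exact: (hn 0 x hx).
- move: hx; rewrite -posz_pred -posz_succ; exact: (hn n.+1 x).
- exact: (h0 x).
- exists 0; rewrite raddf0; apply: esym; apply: hom_to_zero; exact: res_neg.
Qed.

End ResolutionSequences.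

Section ResolutionMaps.
Variables (C : precat) (S T : subcat C) (M : C).
Variables (P : resolution S M) (Q : resolution T M).

Lemma res_map_comm (f : forall i, hom (P i) (Q i)) :
  (forall n, f (Posz n) ∘ cd P (Posz n.+1) (Posz n) =
             cd Q (Posz n.+1) (Posz n) ∘ f (Posz n.+1)) ->
  forall i j, f j ∘ cd P i j = cd Q i j ∘ f i.
Proof.
move=> hf i j; case: (eqVneq i (j + 1)) => [->|hij]; last first.
  by rewrite !cd_shape // compm0 comp0m.
case: j => n; first by rewrite -posz_succ.
by apply: hom_to_zero; exact: res_neg.
Qed.

Definition res_map (f : forall n, hom (res_seq P n) (res_seq Q n)) i :
    hom (P i) (Q i) :=
  match i with Posz n => f n | Negz _ => 0 end.

(** The equality of functions allows a family of lifts to be replaced outright by a chain map. *)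
Lemma res_chain_map_ex (f : forall n, hom (res_seq P n) (res_seq Q n)) :
  sq_lifts_id f ->
  exists F : chain_map P Q, lifts_id F /\ (fun n => F (Posz n)) = f.
Proof.
move=> [f0 fd]; have h := @res_map_comm (res_map f) fd.
by exists (ChainMap h).
Qed.

Lemma res_sq_lifts_id (f : chain_map P Q) :
  lifts_id f -> @sq_lifts_id C M (res_seq P) (res_seq Q) (fun n => f (Posz n)).
Proof. by move=> hf; split=> [|n]; [exact: esym | exact: cm_comm]. Qed.

Lemma res_cx_null (u : forall i, hom (P i) (Q i)) :
  @sq_null C M (res_seq P) (res_seq Q) (fun n => u (Posz n)) ->
  forall i, cx_null (u i).
Proof.
move=> [[s0 hs0] hs] [[|n]|n].
- by exists 1, (-1), s0, 0; rewrite comp0m addr0.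
- have [s [s' e]] := hs n; exists (Posz n.+2), (Posz n), s', s.
  by split; [exact: posz_succ | exact: posz_pred | exact: e].
- exists (Negz n + 1), (Negz n - 1), 0, 0; split=> //.
  by apply: hom_from_zero; exact: res_neg.
Qed.

End ResolutionMaps.

(** * Coresolutions as augmented sequences in the opposite category *)

(** The integer [-n], by cases so that a successor computes to [Negz], as in the coaugmented
    complex. *)
Definition nposz (n : nat) : int := if n is m.+1 then Negz m else 0.

Lemma nposz_pred n : nposz n.+1 = nposz n - 1.
Proof. by case: n => [|n] //=; exact: negz_pred. Qed.

Lemma nposz_succ n : nposz n = nposz n.+1 + 1.
Proof. by rewrite nposz_pred subrK. Qed.

Section CoresolutionSequences.
Variables (C : precat) (S : subcat C) (N : C).
Implicit Types X : coresolution S N.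

Definition cores_seq X : @augseq (op C) N :=
  @AugSeq (op C) N (fun n => X (nposz n)) (cores_aug X)
    (fun n => cd X (nposz n) (nposz n.+1)) (cores_d_aug X _)
    (fun n => cd_cd X _ _ _).

Lemma cores_seq_exact (hC : abelian C) X : sq_exact (cores_seq X).
Proof.
have [Z [z [p [[hz [b [hb hp]]] ep]]]] := cores_H0 X.
(* The term in degree 1 is zero, so [b] vanishes and its cokernel [p] is an isomorphism; hence
   [cores_aug] is a kernel, as [z] is. *)
have [v hv] : exists v, v ∘ p = idm Z.
  apply: cokernel_factor hp _; apply: hom_from_zero; exact: cores_pos.
have pv : p ∘ v = idm N.
  by apply: (cokernel_epi hp); rewrite -compA hv compm1 comp1m.
have maug : mono (cores_aug X).
  apply: mono_of_cancel0 => c u u0.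
  have vu : v ∘ u = 0.
    apply: (mono_cancel0 (kernel_mono hz)).
    by rewrite -ep compA -(compA _ p v) pv compm1.
  by rewrite -[u]comp1m -pv -compA vu compm0.
have kaug : is_kernel (cd X 0 (Negz 0)) (cores_aug X).
  apply: kernel_of_mono => // [|t u /(kernel_lift hz) [w hw]].
    exact: cores_d_aug.
  by exists (p ∘ w); rewrite compA ep.
split=> [c u w|[|n]]; first exact: maug.
  have hid : epi (idm N) by move=> c u w; rewrite !compm1.
  have [K [i [m [hi hm e]]]] := exact_dual hC kaug hid (compm1 _).
  by exists K, i, m.
have [Z' [z' [b' [hz' hb' e']]]] := homology_vanishes_exact
  (cores_acyclic X (erefl : Negz n < 0)) (nposz_pred n.+1) (nposz_succ n).
have [K [i [m [hi hm e]]]] := exact_dual hC hz' hb' e'.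
by exists K, i, m.
Qed.

Lemma homXN_exactP (X : complex C) (c : C) :
  zexact (homXN X c) <->
  forall n j k : int, j = n + 1 -> k = n - 1 ->
    forall x : hom (X n) c, x ∘ cd X j n = 0 ->
      exists y : hom (X k) c, y ∘ cd X n k = x.
Proof.
split=> [/zexactP h n j k ej ek|h].
  have := h (- n) (- j) (- k); rewrite /= /precomp !opprK; apply.
    by rewrite ej opprD.
  by rewrite ek opprB addrC.
apply/zexactP => n j k -> ->; apply: h; first by rewrite opprB addrC.
by rewrite opprD.
Qed.

Lemma proper_coresP X :
  proper_cores X <-> forall c, S c -> @hom_exact (op C) c N (cores_seq X).
Proof.
split=> h c hc.
  have {}h := (homXN_exactP _ _).1 (h c hc); split=> [a|[|n] a ha].
  - exact: (h (Posz 1) (Posz 2) (Posz 0) erefl erefl a (compm0 _ _)).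
  - exact: (h (Posz 0) (Posz 1) (Negz 0) erefl erefl a ha).
  - case: n a ha => [|n] a ha.
      exact: (h (Negz 0) (Posz 0) (Negz 1) erefl erefl a ha).
    exact: (h (Negz n.+1) (Negz n) (Negz n.+2) (nposz_succ n.+1)
              (nposz_pred n.+2) a ha).
have [h0 hn] := h c hc; apply/homXN_exactP => -[[|[|n]]|n] j k -> -> x hx.
- exact: (hn 0 x hx).
- exact: (h0 x).
- exists 0; rewrite comp0m; apply: hom_from_zero; exact: cores_pos.
- have e : Negz n + 1 = nposz n by rewrite (nposz_succ n).
  have e' : Negz n - 1 = Negz n.+1 by rewrite -negz_pred.
  move: hx; rewrite e e'; case: n x {e e'} => [|n] x; [exact: (hn 1 x) | exact: (hn n.+2 x)].
Qed.

End CoresolutionSequences.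

Section CoresolutionMaps.
Variables (C : precat) (S T : subcat C) (N : C).
Variables (P : coresolution S N) (Q : coresolution T N).

Lemma cores_map_comm (f : forall i, hom (P i) (Q i)) :
  (forall n, f (nposz n.+1) ∘ cd P (nposz n) (nposz n.+1) =
             cd Q (nposz n) (nposz n.+1) ∘ f (nposz n)) ->
  forall i j, f j ∘ cd P i j = cd Q i j ∘ f i.
Proof.
move=> hf i j; case: (eqVneq j (i - 1)) => [->|hij]; last first.
  have h : i != j + 1 by apply: contra hij => /eqP ->; rewrite addrK.
  by rewrite !cd_shape // compm0 comp0m.
have hn n : f (nposz n - 1) ∘ cd P (nposz n) (nposz n - 1) =
    cd Q (nposz n) (nposz n - 1) ∘ f (nposz n).
  by rewrite -nposz_pred.
case: i => [[|n]|n]; [exact: (hn 0) | | exact: (hn n.+1)].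
by apply: hom_from_zero; exact: cores_pos.
Qed.

Definition cores_map
    (f : forall n, @hom (op C) (cores_seq Q n) (cores_seq P n)) i :
    hom (P i) (Q i) :=
  match i with
  | Posz 0 => f 0
  | Posz _.+1 => 0
  | Negz n => f n.+1
  end.

Lemma cores_chain_map_ex
    (f : forall n, @hom (op C) (cores_seq Q n) (cores_seq P n)) :
  sq_lifts_id f ->
  exists F : chain_map P Q, colifts_id F /\ (fun n => F (nposz n)) = f.
Proof.
move=> [f0 fd].
have h : forall i j, cores_map f j ∘ cd P i j = cd Q i j ∘ cores_map f i.
  by apply: cores_map_comm => -[|n]; apply: esym; [exact: (fd 0) | exact: (fd n.+1)].
exists (ChainMap h); split; first exact: esym.
by apply: functional_extensionality_dep; case.
Qed.

Lemma cores_sq_lifts_id (f : chain_map P Q) :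
  colifts_id f ->
  @sq_lifts_id (op C) N (cores_seq Q) (cores_seq P) (fun n => f (nposz n)).
Proof. by move=> hf; split=> [|n]; apply: esym; [exact: hf | exact: cm_comm]. Qed.

Lemma cores_cx_null (u : forall i, hom (P i) (Q i)) :
  @sq_null (op C) N (cores_seq Q) (cores_seq P) (fun n => u (nposz n)) ->
  forall i, cx_null (u i).
Proof.
move=> [[s0 hs0] hs].
have hn n : cx_null (u (nposz n.+1)).
  have [s [s' e]] := hs n; exists (nposz n), (nposz n.+2), s, s'.
  (* Composition in [op C] is reversed, so the two summands of the homotopy trade places. *)
  by split; [exact: nposz_succ | exact: nposz_pred | rewrite addrC; exact: e].
case=> [[|n]|n]; last exact: (hn n).
  exists 1, (-1), 0, s0; split=> //; rewrite compm0 add0r; exact: hs0.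
exists (Posz n.+1 + 1), (Posz n.+1 - 1), 0, 0; split=> //.
by apply: hom_from_zero; exact: cores_pos.
Qed.

End CoresolutionMaps.

Theorem proposition4p8 (A : precat) (hA : abelian A)
  (W X V Y : subcat A) (hWX : sub_le W X) (hVY : sub_le V Y)
  (hXW : perp X W) (hVY_perp : perp V Y)
  (M N : A) (hM : res_hat W M) (hN : cores_hat V N) :
  ((exists P : resolution W M, proper_res P) /\
   (exists Q : resolution X M, proper_res Q) /\
   (forall (P : resolution W M) (Q : resolution X M),
      proper_res P -> proper_res Q ->
      (exists f : chain_map P Q, lifts_id f) /\
      (forall f : chain_map P Q, lifts_id f ->
         forall n : int, is_nat_iso (theta_res f n)))) /\
  ((exists P : coresolution Y N, proper_cores P) /\
   (exists Q : coresolution V N, proper_cores Q) /\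
   (forall (P : coresolution Y N) (Q : coresolution V N),
      proper_cores P -> proper_cores Q ->
      (exists f : chain_map P Q, colifts_id f) /\
      (forall f : chain_map P Q, colifts_id f ->
         forall n : int, is_nat_iso (theta_cores f n)))).
Proof.
split.
  have [B [b hb]] := hM.
  have hBX c : X c -> hom_exact c (res_seq B).
    (* The integer [b] may be negative; [|b|.+1] is a natural number above it. *)
    move=> hc; apply: (bounded_hom_exact hA (W := W) (b := `|b|.+1)).
    - exact: res_seq_exact.
    - by move=> n; exact: res_in.
    - by move=> n hn; apply: hb; apply: le_lt_trans (lez_abs b) _.
    - by move=> w hw n; exact: hXW.
  (* The same complex [B], with its terms regarded in [X], is the proper resolution by [X]. *)
  pose BX := @Resolution A X M B (fun n => hWX _ (res_in B n)) (@res_neg _ _ _ B)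
    (@res_acyclic _ _ _ B) (res_aug B) (res_aug_d B) (res_H0 B).
  split; first by exists B; apply/proper_resP => c /hWX /hBX.
  split; first by exists BX; apply/proper_resP => c /hBX.
  move=> P Q /proper_resP hP /proper_resP hQ; split.
    have [n|f hf] := @sq_lift _ _ (res_seq P) (res_seq Q).
      by apply/hQ/hWX; exact: res_in.
    by have [F [hF _]] := res_chain_map_ex hf; exists F.
  move=> f /res_sq_lifts_id hf.
  (* [Q] lifts to [B] because its terms lie in [X], and [B] lifts to [P] because its terms lie in
     [W]. *)
  have [n|n|n|n|k [hk [hkf hfk]]] := sq_inverse (B := res_seq B) _ _ _ _ hf.
  - by apply: hBX; exact: res_in.
  - by apply: hP; exact: res_in.
  - by apply: hP; exact: res_in.
  - by apply: hQ; exact: res_in.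
  have [K [_ ek]] := res_chain_map_ex hk; subst k.
  by apply: (theta_res_iso (k := K)); apply: res_cx_null.
have [B [b hb]] := hN.
have hBY c : Y c -> @hom_exact (op A) c N (cores_seq B).
  move=> hc; apply: (bounded_hom_exact (abelian_op hA) (W := V) (b := `|b|.+1)).
  - exact: cores_seq_exact.
  - by move=> n; exact: cores_in.
  (* Index 0 lies below the bound; index [n.+1] is degree [Negz n], which is less than [b] because
     [-b <= |b| < n.+1]. *)
  - move=> [//|n] hn; apply: is_zero_op; apply: hb.
    rewrite /= NegzE ltrNl; apply: le_lt_trans (lez_abs (- b)) _.
    by rewrite abszN.
  - by move=> w hw n; apply: (perp_op hVY_perp).
pose BY := @Coresolution A Y N B (fun n => hVY _ (cores_in B n)) (@cores_pos _ _ _ B)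
  (@cores_acyclic _ _ _ B) (cores_aug B) (cores_d_aug B) (cores_H0 B).
split; first by exists BY; apply/proper_coresP => c /hBY.
split; first by exists B; apply/proper_coresP => c /hVY /hBY.
move=> P Q /proper_coresP hP /proper_coresP hQ; split.
  (* In the opposite category a map [P -> Q] runs from [Q] to [P], so the coresolution [Q] by [V]
     takes the place of the resolution by [W]. *)
  have [n|f hf] := @sq_lift _ _ (cores_seq Q) (cores_seq P).
    by apply/hP/hVY; exact: cores_in.
  by have [F [hF _]] := cores_chain_map_ex hf; exists F.
move=> f /cores_sq_lifts_id hf.
have [n|n|n|n|k [hk [hkf hfk]]] := sq_inverse (B := cores_seq B) _ _ _ _ hf.
- by apply: hBY; exact: cores_in.
- by apply: hQ; exact: cores_in.
- by apply: hQ; exact: cores_in.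
- by apply: hP; exact: cores_in.
have [K [_ ek]] := cores_chain_map_ex hk; subst k.
by apply: (theta_cores_iso (k := K)); apply: cores_cx_null.
Qed.
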